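(* Let $\mu\in\mathbb{R}$, $\sigma>0$, $S_0>0$ be constants, let $\tilde\mu=\mu-\sigma^2/2$, and let $S_t=S_0\exp(\tilde\mu t+\sigma B_t)$ for $t\ge0$. Let $k>0$, $\lambda>0$, and let $T$ be a random variable independent of $(B_t)_{t\ge0}$ with the gamma distribution $\mathrm{Gamma}(k,\lambda)$ with shape parameter $k$ and rate parameter $\lambda$. Then the probability density function of $S_T$ is, for $x>0$, $x\neq S_0$, $$f_{\mathrm{Gamma}}(x)=\frac{2\lambda^k}{\sqrt{2\pi}\,\Gamma(k)\,\sigma\,(\tilde\mu^2+2\sigma^2\lambda)^{(2k-1)/4}\,S_0}\left(\frac{x}{S_0}\right)^{\tilde\mu/\sigma^2-1}\left|\ln\frac{x}{S_0}\right|^{k-1/2}K_{k-1/2}\!\left(\frac{\sqrt{\tilde\mu^2+2\sigma^2\lambda}}{\sigma^2}\left|\ln\frac{x}{S_0}\right|\right).$$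
   Context: $(B_t)_{t\ge0}$ is a standard one-dimensional Brownian motion with $B_0=0$; $S_t$ is geometric Brownian motion, the It\^o solution of $dS_t=\mu S_t\,dt+\sigma S_t\,dB_t$ started at $S_0$, and $S_T$ is its value at the random time $T$. $K_\nu$ is the modified Bessel function of the second kind and $\Gamma$ the gamma function. $\mathrm{Gamma}(k,\lambda)$ is the distribution on $(0,\infty)$ with density $\frac{\lambda^k}{\Gamma(k)}t^{k-1}e^{-\lambda t}$. *)

(* Defs.v *)
From HB Require Import structures.
From mathcomp Require Import all_boot all_order all_algebra.
From mathcomp Require Import all_classical all_reals all_analysis.

Set Implicit Arguments.
Unset Strict Implicit.
Unset Printing Implicit Defensive.

Import Order.TTheory GRing.Theory Num.Theory.
Import numFieldNormedType.Exports.

Local Open Scope classical_set_scope.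
Local Open Scope ring_scope.

Definition gamma_fun (R : realType) (a : R) : R :=
  (\int[lebesgue_measure]_(t in `]0, +oo[) (t `^ (a - 1) * expR (- t)))%R.

(* [y] restricted to ]0, +oo[ solves the modified Bessel equation of order [nu]
   and y x ~ sqrt (pi / (2 x)) * exp (- x) as x --> +oo (NIST DLMF 10.25.1 and
   10.25.3). For every real [nu] exactly one function on ]0, +oo[ has these
   properties; the values of [y] outside ]0, +oo[ are unconstrained. *)
Definition is_besselK (R : realType) (nu : R) (y : R -> R) : Prop :=
  [/\ forall x : R, 0 < x -> derivable y x 1 /\ derivable (derive1 y) x 1,
      forall x : R, 0 < x ->
        x ^+ 2 * derive1n 2 y x + x * derive1 y x - (x ^+ 2 + nu ^+ 2) * y x = 0
    & y x / (Num.sqrt (pi / (2 * x)) * expR (- x)) @[x --> +oo] --> (1 : R)].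

(* Only meaningful at positive arguments. *)
Definition besselK (R : realType) (nu : R) : R -> R :=
  xget (fun=> 0) [set y | is_besselK nu y].

Section probability_notions.
Context (R : realType) (d : measure_display) (Omega : measurableType d).
Variable P : probability Omega R.

Definition has_pdf (X : {RV P >-> R}) (f : R -> R) : Prop :=
  [/\ measurable_fun setT f, forall x, 0 <= f x
    & forall A : set R, measurable A ->
        distribution P X A = (\int[lebesgue_measure]_(x in A) (f x)%:E)%E].

(* The product rule for subfamilies is the case where some [A i] are [setT]. *)
Definition mutually_independent (n : nat) (X : nat -> Omega -> R) : Prop :=
  forall A : nat -> set R, (forall i, measurable (A i)) ->
    P (\bigcap_(i in `I_n) (X i @^-1` A i)) =
    (\prod_(i < n) P (X i @^-1` A i))%E.

(* Processes are indexed by all of [R]; only the times t >= 0 matter. *)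
Definition process_events (B : R -> Omega -> R) : set (set Omega) :=
  <<s [set C | exists t : R, exists A : set R,
         [/\ 0 <= t, measurable A & C = B t @^-1` A]] >>.

Definition independent_of_process (X : Omega -> R) (B : R -> Omega -> R)
    : Prop :=
  forall (A : set R) (C : set Omega), measurable A -> process_events B C ->
    P (X @^-1` A `&` C) = (P (X @^-1` A) * P C)%E.

(* The second parameter of [normal_prob] is the standard deviation. *)
Record is_brownian_motion (B : R -> Omega -> R) : Prop := {
  bm_measurable : forall t : R, 0 <= t -> measurable_fun setT (B t) ;
  bm_start : {ae P, forall w, B 0 w = 0} ;
  bm_increments_gaussian : forall s t : R, 0 <= s -> s < t ->
    forall A : set R, measurable A ->
      P ((fun w => B t w - B s w) @^-1` A) = normal_prob 0 (Num.sqrt (t - s)) A ;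
  bm_increments_independent : forall (n : nat) (t : nat -> R), 0 <= t 0%N ->
    (forall i, (i < n)%N -> t i < t i.+1) ->
    mutually_independent n (fun i w => B (t i.+1) w - B (t i) w) ;
  bm_continuous :
    {ae P, forall w, {within `[0, +oo[, continuous (fun t => B t w)}} }.

End probability_notions.

Definition gamma_pdf (R : realType) (k lambda : R) (t : R) : R :=
  if 0 < t
  then lambda `^ k / gamma_fun k * t `^ (k - 1) * expR (- (lambda * t))
  else 0.

Definition log_drift (R : realType) (mu sigma : R) : R := mu - sigma ^+ 2 / 2.

Definition geometric_bm (R : realType) (Omega : Type) (S0 mu sigma : R)
    (B : R -> Omega -> R) (t : R) (w : Omega) : R :=
  S0 * expR (log_drift mu sigma * t + sigma * B t w).

(* Extended by 0 to x <= 0 and x = S0; the point S0 is negligible. *)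
Definition gbm_gamma_pdf (R : realType) (S0 mu sigma k lambda : R) (x : R) : R :=
  let m := log_drift mu sigma in
  let D := m ^+ 2 + 2 * sigma ^+ 2 * lambda in
  if (0 < x) && (x != S0) then
    2 * lambda `^ k
      / (Num.sqrt (2 * pi) * gamma_fun k * sigma
         * D `^ ((2 * k - 1) / 4) * S0)
    * (x / S0) `^ (m / sigma ^+ 2 - 1)
    * `|ln (x / S0)| `^ (k - 1 / 2)
    * besselK (k - 1 / 2) (Num.sqrt D / sigma ^+ 2 * `|ln (x / S0)|)
  else 0.

(* Main.v *)
Require Import Defs.
From HB Require Import structures.
From mathcomp Require Import all_boot all_order all_algebra.
From mathcomp Require Import all_classical all_reals all_analysis.
From mathcomp Require Import measurable_realfun.
From mathcomp Require Import ring lra.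

Set Implicit Arguments.
Unset Strict Implicit.
Unset Printing Implicit Defensive.

Import Order.TTheory GRing.Theory Num.Theory.
Import numFieldNormedType.Exports.

Local Open Scope classical_set_scope.
Local Open Scope ring_scope.

(** Conditionally on T = t the value S_T has the lognormal density
    [gbm_pdf t] of S_t, so its density is the mixture
    [int_0^oo gbm_pdf t x * gamma_pdf k lambda t dt].  Completing the square in
    the exponent leaves, up to factors independent of t, an integral
      [int_0^oo t ^ (nu - 1) * exp (- beta / t - gamma * t) dt], nu = k - 1/2,
    with beta = l ^ 2 / (2 sigma ^ 2), gamma = (m ^ 2 / sigma ^ 2 + 2 lambda) / 2
    and l = ln (x / S0).  The substitution t = sqrt (beta / gamma) * e ^ u turns
    it into the integral over the line of e ^ (nu u - z cosh u), which is
    2 K_nu (z) with z = 2 sqrt (beta * gamma).  This is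
    [gbm_gamma_mixture].

    Two points need work.

    - The Bessel function is specified by its differential equation and its
      behaviour at infinity, so the integral above has to be shown to have these
      properties and to be the only function that has them.  The functions
      [macdonald nu] satisfy two three-term recurrences, one from
      differentiating in x under the integral sign and one from the translation
      invariance of the Lebesgue measure; together they give the Bessel equation
      [bessel_equation].  Laplace's method, in the form of dominated convergence
      after the rescaling u = s / sqrt x, gives the asymptotics
      [macdonald_asymp].  A second solution y has a Wronskian with K that is
      c / x, so (y / K)' = c / (x K ^ 2) explodes at infinity unless c = 0, while
      y / K tends to 1; hence y = K [is_besselK_unique].

    - Evaluating the process at the random time T requires measurability in the
      pair (t, path), and the statement P (S_T in A) = E [G (T)] with
      G t = P (S_t in A) requires the law of that pair.  Independence says
      exactly that the pair (T, path), with the path space carrying the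
      sigma-algebra generated by the process, is distributed according to a
      product measure [time_and_path_law].  Almost every path is continuous, so
      B_t is the limit of B along the grids of mesh 1 / (n + 1); the upper limit
      [path_limit] of these discretizations is jointly measurable everywhere and
      is the value of the process along almost every path. *)

(** * Exponential moments *)

Section exponential_moments.
Context {R : realType}.
Local Notation mu := (@lebesgue_measure R).
Implicit Types (nu a b u x : R).

Lemma expR_ge1D2 (v : R) : 0 <= v -> 1 + v + v ^+ 2 / 2 <= expR v.
Proof.
move=> v0; pose f (t : R) := expR t - (1 + t + t ^+ 2 / 2).
suff : f 0 <= f v by rewrite /f expR0; lra.
have df (t : R) : is_derive t 1 f (expR t - (1 + t)).
  rewrite /f; apply: is_derive_eq; rewrite !scaler1 /GRing.scale/=; lra.
apply: (@ger0_derive1_le_cc _ f 0 v) => //.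
- move=> t _; rewrite derive1E derive_val subr_ge0; exact: expR_ge1Dx.
- by apply: derivable_within_continuous => t _.
- by rewrite in_itv/= lexx.
- by rewrite in_itv/= v0 lexx.
Qed.

(** With p = exp (u / 2) the claim is |u| <= |p - 1/p|, which follows from the
    second-order lower bound on the exponential. *)
Lemma two_cosh_ge (u : R) : 2 + u ^+ 2 <= expR u + expR (- u).
Proof.
wlog u0 : u / 0 <= u => [h|].
  have [/h//|u0] := leP 0 u.
  by have := h (- u); rewrite sqrrN opprK addrC [expR _ + _]addrC => -> //; lra.
pose v := u / 2; pose p := expR v.
have p0 : 0 < p by exact: expR_gt0.
have -> : expR u = p ^+ 2 by rewrite /p expr2 -expRD; congr expR; rewrite /v; lra.
have -> : expR (- u) = (p ^+ 2)^-1.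
  by rewrite expRN; congr _^-1; rewrite /p expr2 -expRD; congr expR; rewrite /v; lra.
have pv : 1 + v + v ^+ 2 / 2 <= p by apply: expR_ge1D2; rewrite /v; lra.
have v0 : 0 <= v by rewrite /v; lra.
(* For q = 1 + v + v ^ 2 / 2 <= p one has q ^ 2 - 1 - 2 v q = v ^ 4 / 4. *)
have h : 2 * v * p <= p ^+ 2 - 1.
  have : 0 <= (p - (1 + v + v ^+ 2 / 2)) * (p + (1 + v + v ^+ 2 / 2) - 2 * v).
    by apply: mulr_ge0; nra.
  have : 0 <= v ^+ 4 by rewrite exprn_even_ge0.
  nra.
have h2 : 2 * v <= p - p^-1.
  rewrite -(ler_pM2r p0) mulrBl mulVf ?gt_eqF//; nra.
have -> : u ^+ 2 = (2 * v) ^+ 2 by congr (_ ^+ _); rewrite /v; lra.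
have : (2 * v) ^+ 2 <= (p - p^-1) ^+ 2 by rewrite ler_sqr ?nnegrE; lra.
have -> : (p - p^-1) ^+ 2 = p ^+ 2 + (p ^+ 2)^-1 - 2 by field; rewrite gt_eqF.
lra.
Qed.

(** In the variable t = exp u, and for the measure dt = t du, this is the
    integrand t ^ (nu - 1) * exp (- a t - b / t) of the Bessel integral.
    Separate coefficients a and b make the family stable under translation of u. *)
Definition bessel_kernel nu a b u : R := expR (nu * u - a * expR u - b * expR (- u)).

Definition bessel_moment nu a b : R := (\int[mu]_u bessel_kernel nu a b u)%R.

Lemma bessel_kernel_gt0 nu a b u : 0 < bessel_kernel nu a b u.
Proof. exact: expR_gt0. Qed.

Lemma is_derive_bessel_kernel nu a b u : is_derive u 1 (bessel_kernel nu a b)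
  ((nu - a * expR u + b * expR (- u)) * bessel_kernel nu a b u).
Proof.
rewrite /bessel_kernel.
have d1 : is_derive u 1 (fun u => nu * u - a * expR u - b * expR (- u))
     (nu - a * expR u + b * expR (- u)).
  apply: is_derive_eq; rewrite /GRing.scale/=; ring.
have := is_derive1_comp (is_derive_expR _) d1.
by rewrite mulrC.
Qed.

Lemma continuous_bessel_kernel nu a b : continuous (bessel_kernel nu a b).
Proof.
move=> u; apply: differentiable_continuous; apply/derivable1_diffP.
by have [] := is_derive_bessel_kernel nu a b u.
Qed.

Lemma measurable_bessel_kernel nu a b : measurable_fun setT (bessel_kernel nu a b).
Proof. by apply: continuous_measurable_fun; exact: continuous_bessel_kernel. Qed.

Lemma integrable_expR_sqr (c : R) : 0 < c ->
  mu.-integrable setT (EFin \o (fun u => expR (- (c * u ^+ 2)))).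
Proof.
move=> c0; pose s : R := Num.sqrt (2 * c)^-1.
have s0 : 0 < s by rewrite sqrtr_gt0 invr_gt0 mulr_gt0.
have s2 : s ^+ 2 = (2 * c)^-1 by rewrite sqr_sqrtr// invr_ge0 mulr_ge0// ltW.
have -> : EFin \o (fun u => expR (- (c * u ^+ 2))) =
    (fun u => (normal_peak s)^-1%:E * (normal_pdf 0 s u)%:E)%E.
  apply/funext => u /=; rewrite normal_pdfE ?gt_eqF// -EFinM mulKf; last first.
    by rewrite gt_eqF// normal_peak_gt0// gt_eqF.
  congr (expR _)%:E; rewrite subr0 s2; field; lra.
by apply: integrableZl => //; exact: integrable_normal_pdf.
Qed.

(** Gaussian domination: the bound 2 cosh u >= 2 + u ^ 2 beats the linear term
    nu u after completing the square. *)
Lemma le_bessel_kernel nu a b c u : 0 < c -> c <= a -> c <= b ->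
  bessel_kernel nu a b u <= expR (nu ^+ 2 / (2 * c) - 2 * c) * expR (- (c / 2 * u ^+ 2)).
Proof.
move=> c0 ca cb; rewrite -expRD ler_expR.
have h := two_cosh_ge u.
have h1 : c * expR u <= a * expR u by rewrite ler_wpM2r// expR_ge0.
have h2 : c * expR (- u) <= b * expR (- u) by rewrite ler_wpM2r// expR_ge0.
have h3 : c * (2 + u ^+ 2) <= c * (expR u + expR (- u)) by rewrite ler_wpM2l// ltW.
have h4 : nu * u <= nu ^+ 2 / (2 * c) + c / 2 * u ^+ 2.
  rewrite -subr_ge0 (_ : _ - _ = (2 * c)^-1 * (nu - c * u) ^+ 2).
    by rewrite mulr_ge0 ?sqr_ge0// invr_ge0; lra.
  field; lra.
nra.
Qed.

Lemma integrable_bessel_kernel nu a b : 0 < a -> 0 < b ->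
  mu.-integrable setT (EFin \o bessel_kernel nu a b).
Proof.
move=> a0 b0; pose c := Num.min a b.
have c0 : 0 < c by rewrite lt_min a0.
pose C := expR (nu ^+ 2 / (2 * c) - 2 * c).
have iC : mu.-integrable setT
    (fun u => C%:E * (expR (- (c / 2 * u ^+ 2)))%:E)%E.
  by apply: integrableZl => //; apply: integrable_expR_sqr; lra.
apply: (le_integrable measurableT _ _ iC).
- by apply/measurable_EFinP; exact: measurable_bessel_kernel.
- move=> u _ /=; rewrite lee_fin !ger0_norm ?mulr_ge0 ?expR_ge0//.
  by apply: le_bessel_kernel => //; rewrite ge_min lexx ?orbT.
Qed.

Lemma bessel_momentE nu a b : 0 < a -> 0 < b ->
  (\int[mu]_u (bessel_kernel nu a b u)%:E)%E = (bessel_moment nu a b)%:E.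
Proof.
move=> a0 b0; rewrite /bessel_moment /Rintegral fineK//.
exact: integrable_fin_num (integrable_bessel_kernel _ a0 b0).
Qed.

(** The integrand is at least a positive constant on the interval [0, 1]. *)
Lemma bessel_moment_gt0 nu a b : 0 < a -> 0 < b -> 0 < bessel_moment nu a b.
Proof.
move=> a0 b0; pose c := expR (- `|nu| - a * expR 1 - b).
have c0 : 0 < c by exact: expR_gt0.
apply: (lt_le_trans c0); rewrite -lee_fin -bessel_momentE//.
have -> : c%:E = (\int[mu]_(u in `[0%R, 1%R]) c%:E)%E.
  by rewrite integral_cst//= lebesgue_measure_itv/= lte01 oppr0 adde0 mule1.
apply: (@le_trans _ _ (\int[mu]_(u in `[0%R, 1%R]) (bessel_kernel nu a b u)%:E)%E).
  apply: ge0_le_integral => //.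
  - by move=> u _; rewrite lee_fin ltW.
  - by apply: measurable_funTS; apply/measurable_EFinP; exact: measurable_bessel_kernel.
  - move=> u; rewrite /= in_itv/= => /andP[u0 u1]; rewrite lee_fin ler_expR.
    have h1 : a * expR u <= a * expR 1 by rewrite ler_pM2l// ler_expR.
    have h2 : b * expR (- u) <= b by rewrite ger_pMr// expR_le1 oppr_le0.
    have h3 : - `|nu| <= nu * u.
      apply: le_trans (lerNnormlW (lexx _)); rewrite normrM lerN2 (ger0_norm u0).
      by rewrite ler_piMr.
    lra.
apply: ge0_subset_integral => //.
- by apply/measurable_EFinP; exact: measurable_bessel_kernel.
- by move=> u _; rewrite lee_fin ltW// bessel_kernel_gt0.
Qed.

End exponential_moments.

Section moment_derivative.
Context {R : realType}.
Local Notation mu := (@lebesgue_measure R).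
Implicit Types (nu a b u x : R).

Lemma bessel_kernel_expR nu a b u :
  bessel_kernel nu a b u * expR u = bessel_kernel (nu + 1) a b u.
Proof. by rewrite -expRD; congr expR; ring. Qed.

Lemma bessel_kernel_expRN nu a b u :
  bessel_kernel nu a b u * expR (- u) = bessel_kernel (nu - 1) a b u.
Proof. by rewrite -expRD; congr expR; ring. Qed.

Lemma ler_bessel_kernel nu a b a' b' u : a' <= a -> b' <= b ->
  bessel_kernel nu a b u <= bessel_kernel nu a' b' u.
Proof.
move=> aa bb; rewrite ler_expR.
have := ler_wpM2r (expR_ge0 u) aa; have := ler_wpM2r (expR_ge0 (- u)) bb; lra.
Qed.

(** Differentiation under the integral sign along an arbitrary curve in the
    (a, b) quadrant.  Differentiating the kernel only shifts the order nu by one,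
    so kernels with the smaller constant coefficient c dominate the derivative.
    It is used along a line, to differentiate in x, and along a hyperbola, to
    differentiate a translation in u. *)
Lemma is_derive_bessel_moment nu (alpha beta alpha' beta' : R -> R) (p0 e c C : R) :
  0 < e -> 0 < c ->
  (forall p, p \in `]p0 - e, p0 + e[ ->
    [/\ is_derive p 1 alpha (alpha' p), c <= alpha p & `|alpha' p| <= C]) ->
  (forall p, p \in `]p0 - e, p0 + e[ ->
    [/\ is_derive p 1 beta (beta' p), c <= beta p & `|beta' p| <= C]) ->
  is_derive p0 1 (fun p => bessel_moment nu (alpha p) (beta p))
    (- (alpha' p0 * bessel_moment (nu + 1) (alpha p0) (beta p0)
        + beta' p0 * bessel_moment (nu - 1) (alpha p0) (beta p0))).
Proof.
move=> e0 c0 Halpha Hbeta.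
have p0I : p0 \in `]p0 - e, p0 + e[ by rewrite in_itv/=; lra.
pose f p u := bessel_kernel nu (alpha p) (beta p) u.
pose g p u := - (alpha' p * bessel_kernel (nu + 1) (alpha p) (beta p) u
                 + beta' p * bessel_kernel (nu - 1) (alpha p) (beta p) u).
pose G u := C * bessel_kernel (nu + 1) c c u + C * bessel_kernel (nu - 1) c c u.
have C0 : 0 <= C.
  by have [_ _] := Halpha _ p0I; apply: le_trans; exact: normr_ge0.
have pos p : p \in `]p0 - e, p0 + e[ -> 0 < alpha p /\ 0 < beta p.
  move=> pI; have [_ ca _] := Halpha _ pI; have [_ cb _] := Hbeta _ pI.
  by split; exact: lt_le_trans c0 _.
have df p u : p \in `]p0 - e, p0 + e[ -> is_derive p 1 (f ^~ u) (g p u).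
  move=> pI; have [da _ _] := Halpha _ pI; have [db _ _] := Hbeta _ pI.
  have d1 : is_derive p 1 (fun p => nu * u - alpha p * expR u - beta p * expR (- u))
     (- (alpha' p * expR u + beta' p * expR (- u))).
    apply: is_derive_eq; rewrite /GRing.scale/=; ring.
  have := is_derive1_comp (is_derive_expR _) d1.
  rewrite /f /bessel_kernel => h; apply: is_derive_eq h _.
  rewrite /g -bessel_kernel_expR -bessel_kernel_expRN /bessel_kernel; ring.
have pfE p u : p \in `]p0 - e, p0 + e[ -> partial1of2 f p u = g p u.
  by move=> pI; rewrite partial1of2E; have [_ ->] := df p u pI.
have intf p : p \in `]p0 - e, p0 + e[ -> mu.-integrable setT (EFin \o f p).
  by move=> /pos[? ?]; exact: integrable_bessel_kernel.
have intG : mu.-integrable setT (EFin \o G).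
  rewrite /G /comp; under eq_fun do rewrite EFinD !EFinM.
  by apply: integrableD => //; apply: integrableZl => //; exact: integrable_bessel_kernel.
have G0 u : 0 <= G u.
  by rewrite addr_ge0// mulr_ge0// ltW// bessel_kernel_gt0.
have Gub p u : p \in `]p0 - e, p0 + e[ -> `|partial1of2 f p u| <= G u.
  move=> pI; rewrite pfE// /g normrN.
  have [_ ca Ca] := Halpha _ pI; have [_ cb Cb] := Hbeta _ pI.
  apply: (le_trans (ler_normD _ _)); rewrite !normrM.
  rewrite !(ger0_norm (ltW (bessel_kernel_gt0 _ _ _ _))) lerD//.
  - by apply: ler_pM => //; [exact/ltW/bessel_kernel_gt0|exact: ler_bessel_kernel].
  - by apply: ler_pM => //; [exact/ltW/bessel_kernel_gt0|exact: ler_bessel_kernel].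
have p0I' : `]p0 - e, p0 + e[%classic p0 by [].
have D := @derivable_under_integral R _ _ mu f setT measurableT p0 _ _ p0I'
  intf (fun p u pI _ => @ex_derive _ _ _ _ _ _ _ (df p u pI)) G G0 intG
  (fun p u pI _ => Gub p u pI).
have E := @differentiation_under_integral R _ _ mu f setT measurableT p0 _ _ p0I'
  intf (fun p u pI _ => @ex_derive _ _ _ _ _ _ _ (df p u pI)) G G0 intG
  (fun p u pI _ => Gub p u pI).
apply: DeriveDef; first exact: D.
rewrite -derive1E [LHS]E.
under eq_Rintegral do rewrite pfE//.
have [a0 b0] := pos _ p0I.
have iZ (k nu' : R) : mu.-integrable setT
    (EFin \o (fun u => k * bessel_kernel nu' (alpha p0) (beta p0) u)).
  rewrite /comp; under eq_fun do rewrite EFinM.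
  by apply: integrableZl => //; exact: integrable_bessel_kernel.
rewrite /g; under eq_Rintegral do rewrite opprD -!mulNr.
rewrite RintegralD// !RintegralZl//; try exact: integrable_bessel_kernel.
by rewrite !mulNr opprD.
Qed.

End moment_derivative.

(** * Bessel's differential equation *)

Section bessel_equation.
Context {R : realType}.
Local Notation mu := (@lebesgue_measure R).
Implicit Types (nu a b u x : R).

Lemma ge0_integral_affine (G : R -> R) (c h : R) : 0 < c ->
  continuous G -> (forall u, 0 <= G u) ->
  (\int[mu]_u (G u)%:E = \int[mu]_u (G (c * u + h) * c)%:E)%E.
Proof.
move=> c0 cG G0; pose F (u : R) : R := c * u + h.
have dF (u : R) : is_derive u 1 F c.
  by apply: is_derive_eq; rewrite /GRing.scale/= mulr1 addr0.
have F'E : F^`()%classic = cst c.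
  by apply/funext => u; rewrite derive1E; have [_ ->] := dF u.
have := @increasing_ge0_integration_by_substitutionT R F G.
rewrite F'E; apply => //.
- by move=> u v uv; rewrite /F ltrD2r ltr_pM2l.
- by move=> u; exact: cvg_cst.
- exact: is_cvg_cst.
- exact: is_cvg_cst.
- apply: (cvg_comp (fun u : R => c * u) (fun v : R => v + h)).
    by apply: gt0_cvgMrNy => //; exact: cvg_id.
  exact: cvg_addrr_Ny.
- apply: (cvg_comp (fun u : R => c * u) (fun v : R => v + h)).
    by apply: gt0_cvgMry => //; exact: cvg_id.
  exact: cvg_addrr.
Qed.

(** Translating u by h multiplies exp u and exp (- u) by reciprocal factors. *)
Lemma bessel_moment_shift nu a b h : 0 < a -> 0 < b ->
  bessel_moment nu (a * expR h) (b * expR (- h)) =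
  expR (- (nu * h)) * bessel_moment nu a b.
Proof.
move=> a0 b0; apply: EFin_inj; rewrite EFinM -!bessel_momentE ?mulr_gt0 ?expR_gt0//.
have -> := @ge0_integral_affine (bessel_kernel nu a b) 1 h ltr01
  (@continuous_bessel_kernel _ nu a b) (fun u => ltW (bessel_kernel_gt0 nu a b u)).
rewrite -ge0_integralZl//; last 2 first.
- apply/measurable_EFinP; apply: measurable_funM => //.
  apply: (measurableT_comp (measurable_bessel_kernel nu a b)).
  by apply: measurable_funD => //; exact: measurable_funM.
- by move=> u _; rewrite lee_fin mulr1 ltW// bessel_kernel_gt0.
apply: eq_integral => u _; rewrite -EFinM mul1r mulr1 /bessel_kernel -expRD.
congr (expR _)%:E; rewrite opprD !expRD; ring.
Qed.

(** The integral representation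
    K_nu (x) = 1/2 * int exp (nu u - x cosh u) du over the real line. *)
Definition macdonald nu x : R := bessel_moment nu (x / 2) (x / 2) / 2.

Lemma macdonald_gt0 nu x : 0 < x -> 0 < macdonald nu x.
Proof. by move=> x0; rewrite divr_gt0// bessel_moment_gt0// divr_gt0. Qed.

Lemma is_derive_macdonald nu x : 0 < x -> is_derive x 1 (macdonald nu)
  (- ((macdonald (nu + 1) x + macdonald (nu - 1) x) / 2)).
Proof.
move=> x0.
have half p : p \in `]x - x / 2, x + x / 2[ ->
    [/\ is_derive p (1 : R) (fun p : R => p / 2) (2^-1 : R), x / 4 <= p / 2
      & `|2^-1 : R| <= 2^-1].
  rewrite in_itv/= => /andP[h1 h2]; split.
  - by apply: is_derive_eq; rewrite /GRing.scale/=; ring.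
  - lra.
  - by rewrite ger0_norm.
have x2 : 0 < x / 2 by lra.
have x4 : 0 < x / 4 by lra.
have D := is_derive_bessel_moment nu x2 x4 half half.
rewrite /macdonald; apply: is_derive_eq.
move: (bessel_moment (nu + 1) _ _) (bessel_moment (nu - 1) _ _) => U V.
rewrite /GRing.scale/=; lra.
Qed.

(** Differentiate the two sides of [bessel_moment_shift], with a = b = x / 2, at h = 0. *)
Lemma macdonald_rec nu x : 0 < x ->
  nu * macdonald nu x = x * (macdonald (nu + 1) x - macdonald (nu - 1) x) / 2.
Proof.
move=> x0.
pose al (h : R) := x / 2 * expR h; pose be (h : R) := x / 2 * expR (- h).
pose c := x / 2 * expR (-1); pose C := x / 2 * expR 1.
have Hal (h : R) : h \in `]0 - 1, 0 + 1[ ->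
    [/\ is_derive h (1 : R) al (al h), c <= al h & `|al h| <= C].
  rewrite in_itv/= => /andP[h1 h2]; split.
  - by apply: is_derive_eq; rewrite /al /GRing.scale/=; ring.
  - by rewrite ler_pM2l ?divr_gt0// ler_expR; lra.
  - rewrite ger0_norm; last by rewrite mulr_ge0 ?expR_ge0//; lra.
    by rewrite ler_pM2l ?divr_gt0// ler_expR; lra.
have Hbe (h : R) : h \in `]0 - 1, 0 + 1[ ->
    [/\ is_derive h (1 : R) be (- be h), c <= be h & `|- be h| <= C].
  rewrite in_itv/= => /andP[h1 h2]; split.
  - by apply: is_derive_eq; rewrite /be /GRing.scale/=; ring.
  - by rewrite ler_pM2l ?divr_gt0// ler_expR; lra.
  - rewrite normrN ger0_norm; last by rewrite mulr_ge0 ?expR_ge0//; lra.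
    by rewrite ler_pM2l ?divr_gt0// ler_expR; lra.
have c0 : 0 < c by rewrite mulr_gt0 ?expR_gt0//; lra.
have [_ D1] := @is_derive_bessel_moment _ nu _ _ _ _ 0 1 c C ltr01 c0 Hal Hbe.
have x2 : 0 < x / 2 by lra.
have d2 : is_derive (0 : R) 1
    (fun h => expR (- (nu * h)) * bessel_moment nu (x / 2) (x / 2))
    (- (nu * bessel_moment nu (x / 2) (x / 2))).
  by apply: is_derive_eq; rewrite /GRing.scale/= !mulr0 oppr0 expR0; ring.
have [_] := d2.
have -> : (fun h => expR (- (nu * h)) * bessel_moment nu (x / 2) (x / 2)) =
    (fun h => bessel_moment nu (al h) (be h)).
  by apply/funext => h; rewrite bessel_moment_shift.
rewrite D1 /al /be oppr0 expR0 mulr1 /macdonald.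
move: (bessel_moment nu _ _) (bessel_moment (nu + 1) _ _) (bessel_moment (nu - 1) _ _) => I U V.
lra.
Qed.

(** Differentiating twice produces the orders nu - 2, nu and nu + 2; the
    recurrence at the orders nu - 1, nu and nu + 1 brings everything back to
    order nu. *)
Lemma bessel_equation nu x : 0 < x ->
  [/\ derivable (macdonald nu) x 1, derivable (derive1 (macdonald nu)) x 1
    & x ^+ 2 * derive1n 2 (macdonald nu) x + x * derive1 (macdonald nu) x
      - (x ^+ 2 + nu ^+ 2) * macdonald nu x = 0].
Proof.
move=> x0.
pose D (y : R) := - ((macdonald (nu + 1) y + macdonald (nu - 1) y) / 2).
have DE (y : R) : 0 < y -> derive1 (macdonald nu) y = D y.
  by move=> y0; rewrite derive1E; have [_ ->] := is_derive_macdonald nu y0.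
have dD : is_derive x 1 D
    ((macdonald (nu + 2) x + 2 * macdonald nu x + macdonald (nu - 2) x) / 4).
  have d1 := is_derive_macdonald (nu + 1) x0.
  have d2 := is_derive_macdonald (nu - 1) x0.
  apply: is_derive_eq.
  rewrite /GRing.scale/= subrK addrK.
  rewrite (_ : nu + 1 + 1 = nu + 2); last by ring.
  rewrite (_ : nu - 1 - 1 = nu - 2); last by ring.
  move: (macdonald nu x) (macdonald (nu + 2) x) (macdonald (nu - 2) x) => K U V.
  lra.
have near0 : \near x, D x = derive1 (macdonald nu) x.
  by near=> y; rewrite DE//; near: y; exact: lt_nbhsr.
have [d2 e2] : is_derive x 1 (derive1 (macdonald nu))
    ((macdonald (nu + 2) x + 2 * macdonald nu x + macdonald (nu - 2) x) / 4).
  exact: near_eq_is_derive near0 dD.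
split => //.
  by have [] := is_derive_macdonald nu x0.
rewrite /derive1n /= -/(derive1 _) derive1E e2 DE// /D.
have r1 := macdonald_rec nu x0.
have r2 := macdonald_rec (nu + 1) x0.
have r3 := macdonald_rec (nu - 1) x0.
move: r2 r3; rewrite addrK subrK.
rewrite (_ : nu + 1 + 1 = nu + 2); last by ring.
rewrite (_ : nu - 1 - 1 = nu - 2); last by ring.
move=> r2 r3.
set A := macdonald (nu + 2) x in r2 *; set B := macdonald (nu - 2) x in r3 *.
set K := macdonald nu x in r1 r2 r3 *.
set U := macdonald (nu + 1) x in r1 r2 *; set V := macdonald (nu - 1) x in r1 r3 *.
transitivity (x / 2 * ((nu + 1) * U) - x / 2 * ((nu - 1) * V)
   - x / 2 * (U + V) - nu * (nu * K)).
  by rewrite r2 r3; field.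
rewrite r1; field.
Unshelve. all: by end_near. Qed.

End bessel_equation.

(** * Asymptotics at infinity *)

Section bessel_asymptotics.
Context {R : realType}.
Local Notation mu := (@lebesgue_measure R).
Implicit Types (nu s t x : R).

(** The kernel exp (nu u - x (cosh u - 1)) in the variables x = t ^ -2 and
    u = t s, where x (cosh u - 1) = (2 sinh (t s / 2) / t) ^ 2 / 2. *)
Definition rescaled_kernel nu t s : R :=
  expR (nu * (t * s) - ((expR (t * s / 2) - expR (- (t * s / 2))) / t) ^+ 2 / 2).

Lemma macdonald_rescaled nu t : 0 < t ->
  (macdonald nu (t ^- 2))%:E =
  ((t / 2 * expR (- t ^- 2))%:E * \int[mu]_s (rescaled_kernel nu t s)%:E)%E.
Proof.
move=> t0; have x0 : 0 < t ^- 2 / 2 by rewrite divr_gt0// invr_gt0 exprn_gt0.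
have E (s : R) : bessel_kernel nu (t ^- 2 / 2) (t ^- 2 / 2) (t * s + 0) * t =
    t * expR (- t ^- 2) * rescaled_kernel nu t s.
  rewrite addr0 mulrC -mulrA; congr (_ * _); rewrite -expRD; congr expR.
  have -> : t * s = t * s / 2 + t * s / 2 by lra.
  rewrite opprD !expRD -(_ : t * s = t * s / 2 + t * s / 2); last by lra.
  set p := t * s / 2.
  have pq : expR p * expR (- p) = 1 by exact: expRxMexpNx_1.
  have -> : - t ^- 2 = - (t ^- 2) * (expR p * expR (- p)) by rewrite pq mulr1.
  by field; rewrite gt_eqF.
rewrite /macdonald mulrC EFinM -bessel_momentE//.
rewrite (ge0_integral_affine 0 t0 (@continuous_bessel_kernel _ _ _ _)); last first.
  by move=> u; exact/ltW/bessel_kernel_gt0.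
under eq_integral do rewrite E EFinM.
have mk : measurable_fun setT (rescaled_kernel nu t).
  apply: (eq_measurable_fun (fun s => (t * expR (- t ^- 2))^-1 *
      (bessel_kernel nu (t ^- 2 / 2) (t ^- 2 / 2) (t * s + 0) * t))).
    by move=> s _; rewrite E mulKf// gt_eqF// mulr_gt0 ?expR_gt0.
  apply: measurable_funM => //; apply: measurable_funM => //.
  apply: (measurableT_comp (measurable_bessel_kernel _ _ _)).
  by apply: measurable_funD => //; exact: measurable_funM.
rewrite ge0_integralZl//; last 3 first.
- exact/measurable_EFinP.
- by move=> s _; rewrite lee_fin expR_ge0.
- by rewrite lee_fin mulr_ge0 ?expR_ge0// ltW.
by rewrite muleA -EFinM mulrA [2^-1 * t]mulrC.
Qed.

(** A bound uniform in t, as needed for dominated convergence: the square of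
    2 sinh (t s / 2) / t is at least s ^ 2, and |t s| <= |s|. *)
Lemma rescaled_kernel_le nu t s : 0 < t -> t <= 1 ->
  rescaled_kernel nu t s <= expR (nu ^+ 2) * expR (- (4^-1 * s ^+ 2)).
Proof.
move=> t0 t1; rewrite -expRD ler_expR.
set p := t * s / 2.
have -> : ((expR p - expR (- p)) / t) ^+ 2 =
    (expR (t * s) + expR (- (t * s)) - 2) / t ^+ 2.
  have -> : t * s = p + p by rewrite /p; lra.
  rewrite opprD !expRD.
  have pq : expR p * expR (- p) = 1 by exact: expRxMexpNx_1.
  have -> : 2 = 2 * (expR p * expR (- p)) :> R by rewrite pq mulr1.
  by field; rewrite gt_eqF.
have h1 : s ^+ 2 <= (expR (t * s) + expR (- (t * s)) - 2) / t ^+ 2.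
  rewrite ler_pdivlMr ?exprn_gt0//.
  by have := two_cosh_ge (t * s); rewrite exprMn; lra.
have h2 : nu * (t * s) <= nu ^+ 2 + (t * s) ^+ 2 / 4.
  have : 0 <= (nu - t * s / 2) ^+ 2 by exact: sqr_ge0.
  nra.
have h3 : (t * s) ^+ 2 <= s ^+ 2.
  by rewrite exprMn ler_piMl ?sqr_ge0// expr_le1// ltW.
lra.
Qed.

Lemma integral_gauss_half :
  (\int[mu]_s (expR (- (s ^+ 2 / 2)))%:E = (Num.sqrt (2 * pi))%:E)%E.
Proof.
have s0 : 0 < Num.sqrt (2 * pi) :> R by rewrite sqrtr_gt0 mulr_gt0// pi_gt0.
have h := integral_normal_pdf 0 (1 : R).
have -> : (fun s : R => (expR (- (s ^+ 2 / 2)))%:E) =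
    (fun s => (Num.sqrt (2 * pi))%:E * (normal_pdf 0 1 s)%:E)%E.
  apply/funext => s; rewrite normal_pdfE ?oner_neq0// -EFinM /normal_peak.
  rewrite (_ : 1 ^+ 2 * pi *+ 2 = 2 * pi); last by rewrite expr1n mul1r mulr_natl.
  rewrite mulVKf ?gt_eqF//; congr (expR _)%:E.
  by rewrite expr1n subr0 mulNr.
rewrite ge0_integralZl// ?h ?mule1//.
- by apply/measurable_EFinP; exact: measurable_normal_pdf.
- by move=> s _; rewrite lee_fin normal_pdf_ge0.
Qed.

Lemma measurable_rescaled_kernel nu t : measurable_fun setT (rescaled_kernel nu t).
Proof.
apply: measurableT_comp => //; apply: measurable_funB.
  by apply: measurable_funM => //; exact: measurable_funM.
apply: measurable_funM => //; apply: measurable_funX; apply: measurable_funM => //.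
have m : measurable_fun setT (fun s : R => t * s / 2).
  by apply: measurable_funM => //; exact: measurable_funM.
apply: measurable_funB; apply: measurableT_comp => //.
exact: measurableT_comp.
Qed.

(** The difference quotient 2 sinh (t s / 2) / t tends to the derivative s. *)
Lemma cvg_rescaled_kernel nu s (t_ : R^nat) :
  (forall n, t_ n != 0) -> t_ n @[n --> \oo] --> 0 ->
  rescaled_kernel nu (t_ n) s @[n --> \oo] --> expR (- (s ^+ 2 / 2)).
Proof.
move=> t0 tcvg.
pose phi (t : R) := expR (t * s / 2) - expR (- (t * s / 2)).
have [d e] : is_derive (0 : R) (1 : R) phi s.
  rewrite /phi; apply: is_derive_eq.
  rewrite /GRing.scale/= !mul0r oppr0 expR0; lra.
have c1 : phi (t_ n) / t_ n @[n --> \oo] --> s.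
  have : h^-1 *: (phi (h *: 1 + 0) - phi 0) @[h --> (0:R)^'] --> s.
    rewrite -e; exact: d.
  move=> /cvgr_dnbhsP/(_ _ (conj t0 tcvg)).
  rewrite /phi !mul0r oppr0 subrr.
  under eq_fun do rewrite scaler1 addr0 subr0 [_ *: _]mulrC.
  by [].
rewrite (_ : - _ = nu * (0 * s) - s ^+ 2 / 2); last by lra.
apply: (cvg_comp _ expR); last exact: continuous_expR.
apply: cvgB.
  by apply: cvgMr; apply: cvgMl.
apply: cvgMl.
by rewrite expr2; under eq_fun do rewrite expr2; exact: cvgM.
Qed.

Lemma cvg_integral_rescaled_kernel nu (t_ : R^nat) :
  (forall n, 0 < t_ n <= 1) -> t_ n @[n --> \oo] --> 0 ->
  (\int[mu]_s (rescaled_kernel nu (t_ n) s)%:E @[n --> \oo] -->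
    (Num.sqrt (2 * pi))%:E)%E.
Proof.
move=> t01 tcvg; rewrite -integral_gauss_half.
pose G s : \bar R := ((expR (nu ^+ 2))%:E * (expR (- (4^-1 * s ^+ 2)))%:E)%E.
have iG : mu.-integrable setT G.
  by apply: integrableZl => //; apply: integrable_expR_sqr; lra.
have mf n : measurable_fun setT (EFin \o rescaled_kernel nu (t_ n)).
  by apply/measurable_EFinP; exact: measurable_rescaled_kernel.
have mg : measurable_fun setT (fun s : R => (expR (- (s ^+ 2 / 2)))%:E).
  apply/measurable_EFinP; apply: measurableT_comp => //.
  by apply: measurableT_comp => //; exact: measurable_funM.
have [||_ _ //] := @dominated_convergence _ _ _ mu _ measurableT _ _ _ mf mg _ iG.
- apply: aeW => s _; apply: cvg_EFin; first exact: nearW.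
  by apply: cvg_rescaled_kernel => // n; rewrite gt_eqF//; case/andP: (t01 n).
- apply: aeW => s n _; rewrite /G lee_fin ger0_norm ?expR_ge0//.
  by apply: rescaled_kernel_le; case/andP: (t01 n).
Qed.

Lemma macdonald_asymp nu :
  macdonald nu x / (Num.sqrt (pi / (2 * x)) * expR (- x)) @[x --> +oo] --> (1 : R).
Proof.
apply/cvg_pinftyP => u uoo.
(* Truncation from below at 1 keeps every term of the sequence t_ in ]0, 1]; it
   changes only finitely many terms. *)
pose v n := Num.max (u n) 1; pose t_ n := Num.sqrt (v n)^-1.
have v1 n : 1 <= v n by rewrite le_max lexx orbT.
have v0 n : 0 < v n by exact: lt_le_trans (v1 n).
have t0 n : 0 < t_ n by rewrite sqrtr_gt0 invr_gt0.
have tv n : t_ n ^- 2 = v n by rewrite /t_ sqr_sqrtr ?invrK// invr_ge0 ltW.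
have t01 n : 0 < t_ n <= 1.
  by rewrite t0/= -sqrtr1 ler_sqrt// invf_le1.
have uv : \forall n \near \oo, u n = v n.
  near=> n; rewrite /v max_l//; near: n; move/cvgryPge : uoo; exact.
have voo : v n @[n --> \oo] --> +oo by apply: cvg_trans uoo; exact: near_eq_cvg.
have tcvg : t_ n @[n --> \oo] --> 0.
  rewrite -[X in _ --> X]sqrtr0.
  apply: (cvg_comp (fun n => (v n)^-1) Num.sqrt); last exact: sqrt_continuous.
  by apply/gtr0_cvgV0 => //; exact: nearW.
have pi0 : 0 < Num.sqrt (2 * pi) :> R by rewrite sqrtr_gt0 mulr_gt0// pi_gt0.
have L := fine_cvg (cvg_integral_rescaled_kernel nu t01 tcvg).
have : (\int[mu]_s rescaled_kernel nu (t_ n) s / Num.sqrt (2 * pi)) @[n --> \oo] -->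
    (Num.sqrt (2 * pi) / Num.sqrt (2 * pi) : R).
  by apply: cvgMl; exact: L.
rewrite divff ?gt_eqF//.
apply: cvg_trans; apply: near_eq_cvg; near=> n.
rewrite (_ : u n = v n); last by near: n.
have h := macdonald_rescaled nu (t0 n).
rewrite tv in h.
have c0 : 0 < t_ n / 2 * expR (- v n) by rewrite mulr_gt0 ?expR_gt0// divr_gt0.
have hI : (\int[mu]_s (rescaled_kernel nu (t_ n) s)%:E =
     ((t_ n / 2 * expR (- v n))^-1 * macdonald nu (v n))%:E)%E.
  by rewrite EFinM h muleA -EFinM mulVf ?gt_eqF// mul1e.
rewrite /Rintegral hI /=.
have -> : Num.sqrt (pi / (2 * v n)) = t_ n * Num.sqrt (2 * pi) / 2.
  rewrite (_ : pi / _ = (v n)^-1 * (2 * pi) / 2 ^+ 2); last first.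
    by field; rewrite gt_eqF.
  by rewrite !sqrtrM ?mulr_ge0 ?invr_ge0 ?pi_ge0 ?(ltW (v0 n))// -exprVn sqrtr_sqr ger0_norm.
by field; rewrite !gt_eqF// expR_gt0.
Unshelve. all: by end_near. Qed.

End bessel_asymptotics.

(** * Uniqueness of the Bessel function *)

Section bessel_uniqueness.
Context {R : realType}.
Implicit Types (nu x : R).

Lemma derive_eq0_cst (f f' : R -> R) : (forall x, 0 < x -> is_derive x 1 f (f' x)) ->
  (forall x, 0 < x -> f' x = 0) -> forall x y, 0 < x -> 0 < y -> f x = f y.
Proof.
move=> df f'0.
have lt x y : 0 < x -> x < y -> f x = f y.
  move=> x0 xy.
  have [||c cI] := @MVT R f f' x y xy.
  - move=> z /[!in_itv]/= /andP[xz _]; apply: df; exact: lt_trans xz.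
  - apply: derivable_within_continuous => z /[!in_itv]/= /andP[xz _].
    by have [] := df z (lt_le_trans x0 xz).
  rewrite f'0 ?mul0r; last first.
    by move: cI; rewrite in_itv/= => /andP[xc _]; exact: lt_trans xc.
  by move/eqP; rewrite subr_eq0 => /eqP.
move=> x y x0 y0; have [xy|yx|->//] := ltgtP x y; first exact: lt.
by apply/esym/lt.
Qed.

Lemma macdonald_is_besselK nu : is_besselK nu (macdonald nu).
Proof.
split; last exact: macdonald_asymp.
  by move=> x x0; have [] := bessel_equation nu x0.
by move=> x x0; have [] := bessel_equation nu x0.
Qed.

(** The Wronskian with K = [macdonald nu] is c / x, whence the derivative of
    y / K is c / (x K ^ 2).  Since K decays exponentially, a nonzero c would make
    y / K vary by at least |c| on every interval [x, x + 1] far enough, although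
    it tends to 1. *)
Lemma is_besselK_unique nu (y : R -> R) : is_besselK nu y ->
  forall x, 0 < x -> y x = macdonald nu x.
Proof.
move=> [dy ey ay]; have [dK eK aK] := macdonald_is_besselK nu.
set K := macdonald nu in dK eK aK *.
have K0 x : 0 < x -> 0 < K x by exact: macdonald_gt0.
have D1 (f : R -> R) x : (forall x, 0 < x -> derivable f x 1 /\ derivable (derive1 f) x 1) ->
    0 < x -> is_derive x 1 f (derive1 f x) /\ is_derive x 1 (derive1 f) (derive1n 2 f x).
  move=> df x0; have [d1 d2] := df x x0.
  split; first by apply: DeriveDef; [exact: d1|rewrite derive1E].
  by apply: DeriveDef; [exact: d2|rewrite -derive1E].
pose W x := x * (derive1 y x * K x - y x * derive1 K x).
pose c := W 1.
(* The derivative of the Wronskian times x is K times the equation of y minus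
   y times the equation of K. *)
have Wc x : 0 < x -> W x = c.
  move=> x0; apply: (@derive_eq0_cst W (fun x => (derive1 y x * K x - y x * derive1 K x)
     + x * (derive1n 2 y x * K x - y x * derive1n 2 K x))) => //.
    move=> {x0}x x0; have [y1 y2] := D1 _ _ dy x0; have [K1 K2] := D1 _ _ dK x0.
    rewrite /W; apply: is_derive_eq.
    move: (derive1n 2 y x) (derive1n 2 K x) (derive1 y x) (derive1 K x) (y x) (K x).
    by move=> ? ? ? ? ? ?; rewrite /GRing.scale/=; ring.
  move=> {x0}x x0; apply: (mulfI (lt0r_neq0 x0)); rewrite mulr0.
  transitivity ((x ^+ 2 * derive1n 2 y x + x * derive1 y x - (x ^+ 2 + nu ^+ 2) * y x) * K x
    - (x ^+ 2 * derive1n 2 K x + x * derive1 K x - (x ^+ 2 + nu ^+ 2) * K x) * y x).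
    move: (derive1n 2 y x) (derive1n 2 K x) (derive1 y x) (derive1 K x) (y x) (K x).
    by move=> *; ring.
  by rewrite ey// eK// !mul0r subrr.
pose q x := y x / K x.
have dq x : 0 < x -> is_derive x 1 q (c / (x * K x ^+ 2)).
  move=> x0; have [y1 y2] := D1 _ _ dy x0; have [K1 K2] := D1 _ _ dK x0.
  have Kx0 := lt0r_neq0 (K0 _ x0).
  rewrite /q; apply: is_derive_eq.
  rewrite -(Wc _ x0) /W /GRing.scale/=; field.
  by rewrite Kx0 (lt0r_neq0 x0).
pose E x := Num.sqrt (pi / (2 * x)) * expR (- x) : R.
have E0 x : 0 < x -> 0 < E x.
  by move=> x0; rewrite mulr_gt0 ?expR_gt0// sqrtr_gt0 divr_gt0 ?pi_gt0// mulr_gt0.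
have q1 : q x @[x --> +oo] --> (1 : R).
  have : (y x / E x) * (K x / E x)^-1 @[x --> +oo] --> (1 * 1^-1 : R).
    by apply: cvgM; [exact: ay|apply: cvgV => //; exact: oner_neq0].
  rewrite invr1 mulr1.
  apply: cvg_trans; apply: near_eq_cvg; near=> x.
  have x0 : 0 < x by near: x; exact: nbhs_pinfty_gt.
  by rewrite /q; field; rewrite !gt_eqF ?E0 ?K0.
have c0 : c = 0.
  apply/eqP/negPn/negP => cn0.
  have nc : 0 < `|c| / 4 by rewrite divr_gt0 ?normr_gt0.
  (* Eventually K <= 2 E, and x * (2 E x) ^ 2 = 2 pi exp (- 2 x). *)
  have small : \forall x \near +oo, x * K x ^+ 2 <= 1.
    have aK2 : \forall x \near +oo, K x / E x < 2.
      by apply: (cvgr_lt _ aK); rewrite ltr1n.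
    have e2 : \forall x \near +oo, expR (- x) < (2 * pi)^-1 :> R.
      by apply: (cvgr_lt _ (@cvgr_expR R)); rewrite invr_gt0 mulr_gt0// pi_gt0.
    near=> x.
    have x0 : 0 < x by near: x; exact: nbhs_pinfty_gt.
    have h1 : K x < 2 * E x by rewrite -ltr_pdivrMr ?E0//; near: x.
    have h2 : expR (- x) < (2 * pi)^-1 by near: x.
    have h3 : expR (- x) <= 1 by rewrite expR_le1; lra.
    have : K x ^+ 2 <= (2 * E x) ^+ 2.
      by rewrite ler_sqr ?nnegrE ?(ltW h1)// ltW ?K0// mulr_gt0 ?E0.
    rewrite !exprMn sqr_sqrtr; last by rewrite divr_ge0 ?pi_ge0// mulr_ge0// ltW.
    rewrite -(ler_pM2l x0) => /le_trans; apply.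
    rewrite (_ : x * _ = (2 * pi) * expR (- x) * expR (- x)); last first.
      by field; rewrite gt_eqF.
    rewrite -[leRHS]mulr1; apply: ler_pM => //; rewrite ?expR_ge0 ?mulr_ge0 ?pi_ge0 ?expR_ge0//.
    rewrite mulrC -ler_pdivlMr ?mulr_gt0 ?pi_gt0// mul1r; exact: ltW.
  have : \forall x \near (+oo : set_system R), False; last by move=> /filter_ex[].
  have q1d : \forall x \near +oo, `|1 - q x| < `|c| / 4.
    by move/cvgrPdist_lt : q1; apply.
  have [A [_ HA]] := small; have [A' [_ HA']] := q1d.
  near=> x.
  have x0 : 0 < x by near: x; exact: nbhs_pinfty_gt.
  have xA : A < x by near: x; apply: nbhs_pinfty_gt; exact: num_real.
  have xA' : A' < x by near: x; apply: nbhs_pinfty_gt; exact: num_real.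
  have := HA' _ xA'; have : A' < x + 1 by lra.
  move=> /HA' /= h1 h2.
  have xx1 : x < x + 1 by rewrite ltrDl.
  have [||z zI] := @MVT R q (fun x => c / (x * K x ^+ 2)) x (x + 1) xx1.
  - move=> z /[!in_itv]/= /andP[xz _]; apply: dq; exact: lt_trans xz.
  - apply: derivable_within_continuous => z /[!in_itv]/= /andP[xz _].
    by have [] := dq z (lt_le_trans x0 xz).
  rewrite (_ : x + 1 - x = 1) ?mulr1; last by rewrite addrAC subrr add0r.
  move=> h.
  move: zI; rewrite in_itv/= => /andP[xz _].
  have z0 := lt_trans x0 xz.
  have h3 : `|c| <= `|q (x + 1) - q x|.
    have D0 : 0 < z * K z ^+ 2 by apply: mulr_gt0 => //; apply: exprn_gt0; exact: K0.
    rewrite h normf_div (gtr0_norm D0) ler_peMr// invf_ge1//.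
    exact: (HA z (lt_trans xA xz)).
  have h4 : `|q (x + 1) - q x| <= `|1 - q x| + `|1 - q (x + 1)|.
    rewrite (_ : _ - _ = (1 - q x) - (1 - q (x + 1))); last first.
      by move: (q x) (q (x + 1)) => ? ?; ring.
    exact: ler_normB.
  have := le_lt_trans h3 (le_lt_trans h4 (ltrD h2 h1)).
  by move: (`|c|) nc => r; clear; lra.
move=> x x0.
have qc z : 0 < z -> q z = q x.
  move=> z0; apply: (@derive_eq0_cst q (fun x => c / (x * K x ^+ 2))) => //.
  by move=> ? _; rewrite c0 mul0r.
have qx : q z @[z --> +oo] --> q x.
  apply: cvg_near_cst; near=> z; apply: qc; near: z; exact: nbhs_pinfty_gt.
have : q x = 1 by rewrite -(cvg_lim (@Rhausdorff R) qx) (cvg_lim (@Rhausdorff R) q1).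
by move/divr1_eq.
Unshelve. all: by end_near. Qed.

Lemma besselKE nu x : 0 < x -> besselK nu x = macdonald nu x.
Proof.
apply: is_besselK_unique; rewrite /besselK.
exact: (xgetPex (fun=> 0) (ex_intro [set y | is_besselK nu y] _
  (macdonald_is_besselK nu))).
Qed.

End bessel_uniqueness.

(** * Measures with a density *)

Section image_density.
Context d d' (T : measurableType d) (T' : measurableType d') (R : realType).
Variables (mu : {measure set T -> \bar R}) (F : T -> T') (f : T -> R).
Hypotheses (mF : measurable_fun setT F) (mf : measurable_fun setT f).
Hypothesis f0 : forall x, 0 <= f x.

(** The image under F of the measure with density f.  The proof arguments are
    recorded in the definition so that the measure structure can be inferred. *)
Definition image_density of measurable_fun setT F & measurable_fun setT f &
    (forall x, 0 <= f x) :=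
  fun A : set T' => (\int[mu]_(x in F @^-1` A) (f x)%:E)%E.

Local Notation nu := (image_density mF mf f0).

Let nu0 : nu set0 = 0%E.
Proof. by rewrite /image_density preimage_set0 integral_set0. Qed.

Let nu_ge0 A : (0 <= nu A)%E.
Proof. by apply: integral_ge0 => x _; rewrite lee_fin. Qed.

Let nu_sigma_additive : semi_sigma_additive nu.
Proof.
move=> E mE tE mUE; rewrite /image_density preimage_bigcup ge0_integral_bigcup//=.
- apply: is_cvg_ereal_nneg_natsum_cond => n _ _.
  by apply: integral_ge0 => x _; rewrite lee_fin.
- by move=> k; rewrite -[X in measurable X]setTI; exact: mF.
- by apply/measurable_EFinP; exact: measurable_funTS.
- by move=> x _; rewrite lee_fin.
- apply/trivIsetP => i j _ _ ij; rewrite -preimage_setI.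
  by move/trivIsetP : tE => /(_ i j I I ij) ->; rewrite preimage_set0.
Qed.

HB.instance Definition _ := isMeasure.Build _ _ _ nu nu0 nu_ge0 nu_sigma_additive.

End image_density.

Section integral_image_density.
Context d d' (T : measurableType d) (T' : measurableType d') (R : realType).
Variables (mu : {measure set T -> \bar R}) (nu : {measure set T' -> \bar R}).
Variables (F : T -> T') (f : T -> R).
Hypotheses (mF : measurable_fun setT F) (mf : measurable_fun setT f).
Hypothesis f0 : forall x, 0 <= f x.
Hypothesis nuE : forall A, measurable A ->
  nu A = (\int[mu]_(x in F @^-1` A) (f x)%:E)%E.
Local Open Scope ereal_scope.
Import HBNNSimple.

Let nnsfun_integral_density (h : {nnsfun T' >-> R}) :
  \int[nu]_y (h y)%:E = \int[mu]_x ((h (F x))%:E * (f x)%:E).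
Proof.
have mh r : measurable (h @^-1` [set r]) by exact: measurable_sfunP.
have mind r : measurable_fun setT (fun y => (\1_(h @^-1` [set r]) y)%:E : \bar R).
  by apply/measurable_EFinP; exact: measurable_indic.
have mrind r : measurable_fun setT (fun y => (r * \1_(h @^-1` [set r]) y)%:E).
  by apply/measurable_EFinP; apply: measurable_funM => //; exact/measurable_EFinP.
under eq_integral do rewrite fimfunE -fsumEFin//.
rewrite ge0_integral_fsum//; last by move=> r y _; exact: nnfun_muleindic_ge0.
have -> : \int[mu]_x ((h (F x))%:E * (f x)%:E) = \int[mu]_x
    (\sum_(r \in range h) ((r * \1_(h @^-1` [set r]) (F x))%:E * (f x)%:E)).
  apply: eq_integral => x _; rewrite -ge0_mule_fsuml; last first.
    by move=> r; exact: nnfun_muleindic_ge0.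
  by rewrite fsumEFin// -fimfunE.
rewrite ge0_integral_fsum//; last 2 first.
- move=> r; apply: emeasurable_funM; last exact/measurable_EFinP.
  exact: (measurableT_comp (mrind r) mF).
- by move=> r x _; apply: mule_ge0; rewrite ?lee_fin//; exact: nnfun_muleindic_ge0.
apply: eq_fsbigr => r /[!inE] -[t _ hr].
have r0 : (0 <= r)%R by rewrite -hr.
under eq_integral do rewrite EFinM.
rewrite ge0_integralZl// integral_indic// setIT nuE//.
under [RHS]eq_integral do rewrite EFinM -muleA.
rewrite ge0_integralZl//; last 2 first.
- apply: emeasurable_funM; last exact/measurable_EFinP.
  exact: (measurableT_comp (mind r) mF).
- by move=> x _; rewrite mule_ge0 ?lee_fin.
congr (_ * _); rewrite integral_mkcond; apply: eq_integral => x _.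
by rewrite epatch_indic/= muleC.
Qed.

(** Reduction to simple functions by monotone convergence. *)
Lemma ge0_integral_image_density (g : T' -> \bar R) : measurable_fun setT g ->
  (forall y, 0 <= g y) -> \int[nu]_y g y = \int[mu]_x (g (F x) * (f x)%:E).
Proof.
move=> mg g0; pose h := nnsfun_approx measurableT mg.
have hg y : (h n y)%:E @[n --> \oo] --> g y by exact: cvg_nnsfun_approx.
have ndh y : {homo (fun n => h n y) : m n / (m <= n)%N >-> (m <= n)%R}.
  by move=> m n mn; exact/lefP/nd_nnsfun_approx.
transitivity (limn (fun n => \int[nu]_y (h n y)%:E)).
  rewrite -monotone_convergence//.
  - by apply: eq_integral => y _; apply/esym/cvg_lim => //; exact: hg.
  - by move=> n; exact/measurable_EFinP.
  - by move=> n y _; rewrite lee_fin.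
  - by move=> y _ m n mn; rewrite lee_fin ndh.
under eq_fun do rewrite nnsfun_integral_density.
rewrite -monotone_convergence//.
- apply: eq_integral => x _; apply/cvg_lim => //.
  by apply: cvgeZr => //; exact: hg.
- move=> n; apply: emeasurable_funM; apply/measurable_EFinP => //.
  exact: measurableT_comp.
- by move=> n x _; rewrite mule_ge0 ?lee_fin.
- by move=> x _ m n mn; rewrite lee_wpmul2r ?lee_fin// ndh.
Qed.

End integral_image_density.

(** The substitution x = A exp (s u), for merely measurable integrands, so that
    it applies to indicators of Borel sets.  The two sides are integrals against
    two measures carried by ]0, +oo[, which have the same finite values on the
    rays ]-oo, x[ and are therefore equal. *)
Section exponential_substitution.
Context {R : realType}.
Local Notation mu := (@lebesgue_measure R).
Variables (A s : R).
Hypotheses (A0 : 0 < A) (s0 : 0 < s).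
Let F (u : R) : R := A * expR (s * u).
Let w (u : R) : R := A * s * expR (s * u).

Let F_gt0 u : 0 < F u. Proof. by rewrite mulr_gt0// expR_gt0. Qed.

Let w_ge0 u : 0 <= w u.
Proof. by rewrite mulr_ge0 ?expR_ge0// mulr_ge0// ltW. Qed.

Let cF : continuous F.
Proof.
move=> u; apply: cvgMr; apply: (cvg_comp (fun u => s * u) expR).
  by apply: cvgMr; exact: cvg_id.
exact: continuous_expR.
Qed.

Let cw : continuous w.
Proof.
move=> u; apply: cvgMr; apply: (cvg_comp (fun u => s * u) expR).
  by apply: cvgMr; exact: cvg_id.
exact: continuous_expR.
Qed.

Let mF : measurable_fun setT F. Proof. exact: continuous_measurable_fun. Qed.

Let mw : measurable_fun setT w. Proof. exact: continuous_measurable_fun. Qed.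

Lemma integral_exp_ray c : (\int[mu]_(u in `]-oo, c]) (w u)%:E = (F c)%:E)%E.
Proof.
have dFN (u : R) : is_derive u 1 (fun u => - F (- u)) (w (- u)).
  rewrite /F /w; apply: is_derive_eq; rewrite /GRing.scale/=; ring.
rewrite -[c in LHS]opprK ge0_integration_by_substitutionNy; last 2 first.
- by apply: continuous_subspaceT.
- by move=> u _.
rewrite (@ge0_continuous_FTC2y _ _ (fun u => - F (- u)) _ 0).
- by rewrite opprK sub0e EFinN oppeK.
- by move=> u _; exact: w_ge0.
- apply: continuous_subspaceT => u; apply: continuous_comp; last exact: cw.
  by apply: cvgN; exact: cvg_id.
- rewrite -[X in _ --> X]oppr0; apply: cvgN.
  rewrite -[X in _ --> X](mulr0 A); apply: cvgMr.
  under eq_fun do rewrite mulrN.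
  apply: (cvg_comp (fun u : R => s * u) (fun u => expR (- u))); last exact: cvgr_expR.
  by apply: gt0_cvgMry => //; exact: cvg_id.
- by move=> u _; have [] := dFN u.
- apply: cvg_at_right_filter; have [d _] := dFN (- c).
  by move/derivable1_diffP/differentiable_continuous : d; exact.
- by move=> u _; rewrite derive1E; have [_ ->] := dFN u.
Qed.

Lemma measure_exp_image (B : set R) : measurable B ->
  (mu (B `&` `]0%R, +oo[%classic) =
   \int[mu]_(u in F @^-1` B) (w u)%:E)%E.
Proof.
move=> mB.
have mpos : measurable (`]0%R, +oo[%classic : set R) by [].
pose m1 : {measure set (measurableTypeR R) -> \bar R} := mrestr mu mpos.
pose m2 : {measure set (measurableTypeR R) -> \bar R} :=
  image_density mu
    (mF : @measurable_fun _ _ (measurableTypeR R) (measurableTypeR R) _ _) mw w_ge0.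
have eqm : forall C : set (measurableTypeR R), measurable C -> m1 C = m2 C.
  apply: (@measure_unique _ R (measurableTypeR R) (@measurable_realfun.RGenInftyO.G R)
      (fun n => `]-oo, n%:R[%classic) _ _ _ _ m1 m2).
  - exact: measurable_realfun.RGenInftyO.measurableE.
  - move=> _ _ [x ->] [y ->]; exists (Num.min x y).
    by apply/seteqP; split => z; rewrite /= !in_itv/= lt_min => /andP.
  - by move=> n; exists n%:R.
  - apply/seteqP; split => // x _; exists (Num.truncn `|x|).+1 => //.
    by rewrite /= in_itv/= (le_lt_trans (ler_norm x))// truncnS_gt.
  - move=> _ [x ->]; rewrite /m1 /m2/= /mrestr /image_density.
    have [x0|x0] := leP x 0.
      rewrite (_ : _ `&` _ = set0) ?measure0; last first.
        apply/seteqP; split => // z [] /=; rewrite !in_itv/= andbT => zx z0.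
        by have := lt_trans z0 (lt_le_trans zx x0); rewrite ltxx.
      rewrite (_ : F @^-1` _ = set0) ?integral_set0//.
      apply/seteqP; split => // u /=; rewrite in_itv/= => Fx.
      by have := lt_trans (F_gt0 u) (lt_le_trans Fx x0); rewrite ltxx.
    have -> : `]-oo, x[ `&` `]0%R, +oo[ = `]0%R, x[%classic.
      by apply/seteqP; split => z; rewrite /= !in_itv/= andbT;
        [move=> [-> ->]|move=> /andP[-> ->]].
    pose c := ln (x / A) / s.
    have Fc : F c = x.
      rewrite /F /c mulrCA divff ?gt_eqF// mulr1 lnK ?posrE ?divr_gt0//.
      by rewrite mulrCA divff ?gt_eqF// mulr1.
    have -> : F @^-1` `]-oo, x[ = `]-oo, c[%classic.
      apply/seteqP; split => u; rewrite /= !in_itv/= -{1}Fc /F;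
        by rewrite ltr_pM2l// ltr_expR ltr_pM2l.
    rewrite lebesgue_measure_itv/= lte_fin x0 oppr0 adde0.
    rewrite integral_itv_bndo_bndc ?integral_exp_ray ?Fc//.
    by apply/measurable_EFinP; exact: measurable_funTS.
  - move=> n; apply: (@le_lt_trans _ _ (mu `]0%R, n%:R])).
      apply: le_measure; rewrite ?inE//; first exact: measurableI.
      by move=> z [] /=; rewrite !in_itv/= andbT => /ltW -> ->.
    by rewrite lebesgue_measure_itv/=; case: ifP => _; rewrite ?ltry// -EFinB ltry.
exact: eqm.
Qed.

Lemma ge0_integral_exp_substitution (g : R -> \bar R) : measurable_fun setT g ->
  (forall x, 0 <= g x)%E ->
  (\int[mu]_(x in `]0%R, +oo[) g x = \int[mu]_u (g (F u) * (w u)%:E))%E.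
Proof.
move=> mg g0.
have mpos : measurable (`]0%R, +oo[%classic : set R) by [].
transitivity (\int[mrestr mu mpos]_x g x)%E; last first.
  apply: ge0_integral_image_density => //.
  by move=> C mC; rewrite -measure_exp_image.
(* The restricted Lebesgue measure has the indicator of ]0, +oo[ as a density. *)
have -> : (\int[mrestr mu mpos]_x g x = \int[mu]_x (g x * (\1_(`]0%R, +oo[%classic) x)%:E))%E.
  apply: (@ge0_integral_image_density _ _ _ _ _ mu (mrestr mu mpos) id) => //.
  by move=> C mC; rewrite preimage_id integral_indic// /mrestr setIC.
by rewrite integral_mkcond; apply: eq_integral => x _; rewrite epatch_indic.
Qed.

End exponential_substitution.

(** * The lognormal law *)

Section measurable_inverse.
Context d (T : measurableType d) (R : realType).

(** Here 0^-1 = 0, and the power with exponent -1 is 0 at 0 and 1 at negative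
    bases, which is why the sign is split off. *)
Lemma measurable_fun_inv (f : T -> R) :
  measurable_fun setT f -> measurable_fun setT (fun x => (f x)^-1).
Proof.
move=> mf; apply: (@measurableT_comp _ _ _ _ _ _ (fun y : R => y^-1)) => //.
have -> : (fun y : R => y^-1) =
    (fun y => if 0 < y then y `^ (-1) else - ((- y) `^ (-1))).
  apply/funext => y; case: ifPn => [y0|]; first by rewrite powR_inv1// ltW.
  by rewrite -leNgt => y0; rewrite powR_inv1 ?oppr_ge0// invrN opprK.
apply: measurable_fun_ifT => //; first exact: measurable_fun_ltr.
apply: measurableT_comp => //; apply: (measurableT_comp (measurable_powR _)).
exact: oppr_measurable.
Qed.

Lemma measurable_fun_sqrt (f : T -> R) :
  measurable_fun setT f -> measurable_fun setT (fun x => Num.sqrt (f x)).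
Proof.
move=> mf; apply: (@measurableT_comp _ _ _ _ _ _ (@Num.sqrt R)) => //.
by apply: continuous_measurable_fun; exact: sqrt_continuous.
Qed.

End measurable_inverse.

Section lognormal.
Context {R : realType}.
Local Notation leb := (@lebesgue_measure R).
Variables (mu sigma S0 : R).
Hypotheses (sigma_gt0 : 0 < sigma) (S0_gt0 : 0 < S0).
Local Notation m := (log_drift mu sigma).

(** The density of S_t at x. *)
Definition gbm_pdf (t x : R) : R :=
  if (0 < t) && (0 < x) then
    expR (- (ln (x / S0) - m * t) ^+ 2 / (2 * sigma ^+ 2 * t))
      / (sigma * x * Num.sqrt (2 * pi * t))
  else 0.

Lemma gbm_pdf_ge0 t x : 0 <= gbm_pdf t x.
Proof.
rewrite /gbm_pdf; case: ifPn => // /andP[t0 x0].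
by rewrite divr_ge0 ?expR_ge0// !mulr_ge0 ?sqrtr_ge0// ltW.
Qed.

Lemma measurable_gbm_pdf d (X : measurableType d) (t x : X -> R) :
  measurable_fun setT t -> measurable_fun setT x ->
  measurable_fun setT (fun z => gbm_pdf (t z) (x z)).
Proof.
move=> mt mx; apply: measurable_fun_ifT => //.
  by apply: measurable_and; exact: measurable_fun_ltr.
apply: measurable_funM; last first.
  apply: measurable_fun_inv; apply: measurable_funM; first exact: measurable_funM.
  by apply: measurable_fun_sqrt; exact: measurable_funM.
apply: measurableT_comp => //; apply: measurable_funM; last first.
  by apply: measurable_fun_inv; exact: measurable_funM.
apply: measurableT_comp => //; apply: measurable_funX; apply: measurable_funB.
  by apply: (measurableT_comp (@measurable_ln R)); exact: measurable_funM.
exact: measurable_funM.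
Qed.

(** Substitute x = S0 exp (m t) * exp (sigma b) in the right-hand side. *)
Lemma normal_prob_gbm t (A : set R) : 0 < t -> measurable A ->
  normal_prob 0 (Num.sqrt t) ((fun b => S0 * expR (m * t + sigma * b)) @^-1` A) =
  (\int[leb]_(x in A) (gbm_pdf t x)%:E)%E.
Proof.
move=> t0 mA; pose F b := S0 * expR (m * t + sigma * b).
pose C := S0 * expR (m * t).
have C0 : 0 < C by rewrite mulr_gt0// expR_gt0.
have FE b : F b = C * expR (sigma * b) by rewrite /F expRD mulrA.
pose g x := ((gbm_pdf t x)%:E * (\1_A x)%:E)%E.
have mg : measurable_fun setT g.
  apply: emeasurable_funM; apply/measurable_EFinP.
    exact: measurable_gbm_pdf.
  exact: measurable_indic.
have g0 x : (0 <= g x)%E by rewrite mule_ge0 ?lee_fin ?gbm_pdf_ge0.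
transitivity (\int[leb]_x g x)%E; last first.
  by rewrite [RHS]integral_mkcond; apply: eq_integral => x _; rewrite epatch_indic.
transitivity (\int[leb]_(x in `]0%R, +oo[) g x)%E; last first.
  rewrite integral_mkcond; apply: eq_integral => x _.
  rewrite patchE; case: ifPn => //; rewrite notin_setE/= in_itv/= andbT => /negP x0.
  by rewrite /g /gbm_pdf (negbTE x0) andbF mul0e.
rewrite (ge0_integral_exp_substitution C0 sigma_gt0 mg g0).
rewrite /normal_prob integral_mkcond; apply: eq_integral => b _.
rewrite epatch_indic muleAC; congr (_ * _)%E; last first.
  by rewrite -FE !indicE; congr (_%:R)%:E; apply/idP/idP; rewrite !inE.
rewrite -EFinM; congr EFin.
have s0 : Num.sqrt t != 0 by rewrite gt_eqF// sqrtr_gt0.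
rewrite normal_pdfE// /gbm_pdf t0 mulr_gt0 ?expR_gt0//=.
have -> : ln (C * expR (sigma * b) / S0) = m * t + sigma * b.
  rewrite (_ : _ / S0 = expR (m * t + sigma * b)) ?expRK//.
  by rewrite expRD /C; field; rewrite gt_eqF.
rewrite /normal_peak /normal_fun subr0 sqr_sqrtr ?ltW//.
have -> : - (m * t + sigma * b - m * t) ^+ 2 / (2 * sigma ^+ 2 * t) = - b ^+ 2 / (t *+ 2).
  by rewrite -[t *+ 2]mulr_natl; field; rewrite !gt_eqF.
have -> : t * pi *+ 2 = 2 * pi * t by rewrite -mulr_natl; ring.
field.
by rewrite !gt_eqF ?expR_gt0// sqrtr_gt0 !mulr_gt0// pi_gt0.
Qed.

End lognormal.

(** * The gamma mixture of lognormal densities *)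

Section gamma_mixture.
Context {R : realType}.
Local Notation leb := (@lebesgue_measure R).
Variables (mu sigma S0 k lambda : R).
Hypotheses (sigma_gt0 : 0 < sigma) (S0_gt0 : 0 < S0) (lambda_gt0 : 0 < lambda).
Local Notation m := (log_drift mu sigma).
Local Notation D := (m ^+ 2 + 2 * sigma ^+ 2 * lambda).

Lemma gamma_fun_ge0 (a : R) : 0 <= gamma_fun a.
Proof. by apply: Rintegral_ge0 => t _; rewrite mulr_ge0 ?powR_ge0 ?expR_ge0. Qed.

Lemma gamma_pdf_ge0 t : 0 <= gamma_pdf k lambda t.
Proof.
rewrite /gamma_pdf; case: ifP => // _.
by rewrite !mulr_ge0 ?expR_ge0 ?powR_ge0// invr_ge0 gamma_fun_ge0.
Qed.

Lemma measurable_gamma_pdf : measurable_fun setT (gamma_pdf k lambda).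
Proof.
apply: measurable_fun_ifT => //; first exact: measurable_fun_ltr.
apply: measurable_funM; first by apply: measurable_funM => //; exact: measurable_powR.
by apply: measurableT_comp => //; apply: measurableT_comp => //; exact: measurable_funM.
Qed.

Let D_gt0 : 0 < D.
Proof. by rewrite ltr_wpDl ?sqr_ge0// !mulr_gt0// exprn_gt0. Qed.

(** The integrand of the mixture after the substitution t = A exp u.  The choice
    A = |l| / sqrt D gives exp u and exp (- u) the same coefficient z / 2 in the
    exponent; the exponents of t combine to k - 1 + 1 - 1/2 = nu, counting the
    Jacobian t and the factor 1 / sqrt t of the Gaussian density. *)
Let integrandE (x u : R) (l := ln (x / S0)) (z := Num.sqrt D / sigma ^+ 2 * `|l|)
    (A := `|l| / Num.sqrt D) (nu := k - 1 / 2) : 0 < x -> l != 0 ->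
  gbm_pdf mu sigma S0 (A * expR (1 * u)) x * gamma_pdf k lambda (A * expR (1 * u))
    * (A * 1 * expR (1 * u)) =
  lambda `^ k / gamma_fun k / (sigma * x * Num.sqrt (2 * pi))
    * expR (l * m / sigma ^+ 2) * A `^ nu * bessel_kernel nu (z / 2) (z / 2) u.
Proof.
move=> x0 l0; rewrite mulr1 mul1r.
have r0 : 0 < Num.sqrt D by rewrite sqrtr_gt0.
have nl0 : 0 < `|l| by rewrite normr_gt0.
have A0 : 0 < A by rewrite divr_gt0.
pose t := A * expR u; have t0 : 0 < t by rewrite mulr_gt0// expR_gt0.
rewrite -/t /gbm_pdf /gamma_pdf t0 x0/= -/l.
have tnu : t `^ (k - 1) * t = A `^ nu * expR (nu * u) * Num.sqrt t.
  transitivity (t `^ (nu + 2^-1)).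
    rewrite -[X in _ * X](powRr1 (ltW t0)) -powRD ?(gt_eqF t0) ?implybT//.
    by congr (_ `^ _); rewrite /nu; lra.
  rewrite powRD ?(gt_eqF t0) ?implybT// powR12_sqrt ?(ltW t0)//; congr (_ * _).
  by rewrite /t powRM ?expR_ge0 ?(ltW A0)// -expRM [u * nu]mulrC.
have expE : expR (- (l - m * t) ^+ 2 / (2 * sigma ^+ 2 * t)) * expR (- (lambda * t)) =
    expR (l * m / sigma ^+ 2) * expR (- (z / 2) * expR u - z / 2 * expR (- u)).
  rewrite -!expRD; congr expR.
  have h1 : l ^+ 2 / (2 * sigma ^+ 2 * t) = z / 2 * expR (- u).
    rewrite -[l ^+ 2]real_normK ?num_real// /t /A /z expRN.
    by field; rewrite !gt_eqF// expR_gt0.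
  have h2 : D * t / (2 * sigma ^+ 2) = z / 2 * expR u.
    rewrite -{1}(sqr_sqrtr (ltW D_gt0)) /t /A /z.
    by field; rewrite !gt_eqF.
  rewrite !mulNr -h1 -h2; field.
  by rewrite !gt_eqF.
have wE : bessel_kernel nu (z / 2) (z / 2) u =
    expR (nu * u) * expR (- (z / 2) * expR u - z / 2 * expR (- u)).
  by rewrite -expRD; congr expR; rewrite mulNr addrA.
have st0 : 0 < Num.sqrt t by rewrite sqrtr_gt0.
have s2pi : 0 < Num.sqrt (2 * pi) :> R by rewrite sqrtr_gt0 mulr_gt0// pi_gt0.
rewrite sqrtrM ?mulr_ge0 ?pi_ge0//.
move: expE wE tnu; set E1 := expR (- _ / _); set E2 := expR (- (lambda * t)).
set E3 := expR (l * m / _); set E4 := expR (_ - _); set E5 := expR (nu * u).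
set tk := t `^ _; set Anu := A `^ nu; set G := lambda `^ k / _.
move=> expE wE tnu.
transitivity (G / (sigma * x * Num.sqrt (2 * pi)) * (E1 * E2) * (tk * t) / Num.sqrt t).
  by field; rewrite !gt_eqF.
rewrite expE tnu wE.
by field; rewrite !gt_eqF.
Qed.

Lemma gbm_gamma_mixture (x : R) : 0 < x -> x != S0 ->
  (\int[leb]_t (gbm_pdf mu sigma S0 t x * gamma_pdf k lambda t)%:E =
   (gbm_gamma_pdf S0 mu sigma k lambda x)%:E)%E.
Proof.
move=> x0 xS0; pose l := ln (x / S0).
have l0 : l != 0.
  by rewrite ln_eq0 ?divr_gt0//; apply: contra xS0 => /eqP/divr1_eq ->.
pose z := Num.sqrt D / sigma ^+ 2 * `|l|; pose A := `|l| / Num.sqrt D.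
have r0 : 0 < Num.sqrt D by rewrite sqrtr_gt0.
have nl0 : 0 < `|l| by rewrite normr_gt0.
have A0 : 0 < A by rewrite divr_gt0.
have z0 : 0 < z by rewrite mulr_gt0// divr_gt0// exprn_gt0.
have z20 : 0 < z / 2 by rewrite divr_gt0.
pose g t := (gbm_pdf mu sigma S0 t x * gamma_pdf k lambda t)%:E.
have mg : measurable_fun setT g.
  apply/measurable_EFinP; apply: measurable_funM; first exact: measurable_gbm_pdf.
  exact: measurable_gamma_pdf.
have g0 t : (0 <= g t)%E by rewrite lee_fin mulr_ge0 ?gbm_pdf_ge0 ?gamma_pdf_ge0.
transitivity (\int[leb]_(t in `]0%R, +oo[) g t)%E.
  rewrite [RHS]integral_mkcond; apply: eq_integral => t _.
  rewrite patchE; case: ifPn => //; rewrite notin_setE/= in_itv/= andbT => /negP t0.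
  by rewrite /gbm_pdf (negbTE t0) mul0r.
rewrite (ge0_integral_exp_substitution A0 ltr01 mg g0).
under eq_integral do rewrite -EFinM integrandE// EFinM.
set C := (_ * _ `^ _).
have C0 : 0 <= C.
  rewrite !mulr_ge0 ?expR_ge0 ?powR_ge0 ?invr_ge0 ?gamma_fun_ge0//.
  by rewrite !mulr_ge0 ?sqrtr_ge0// ltW.
rewrite ge0_integralZl//; last 2 first.
- by apply/measurable_EFinP; exact: measurable_bessel_kernel.
- by move=> u _; rewrite lee_fin ltW// bessel_kernel_gt0.
rewrite bessel_momentE// -EFinM; congr EFin.
rewrite /gbm_gamma_pdf x0 xS0/= -/l -/z besselKE// /macdonald /C.
have -> : (x / S0) `^ (m / sigma ^+ 2 - 1) = expR (l * m / sigma ^+ 2) * (S0 / x).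
  rewrite /powR gt_eqF ?divr_gt0// -/l mulrBl mul1r expRB.
  rewrite (_ : m / sigma ^+ 2 * l = l * m / sigma ^+ 2); last by ring.
  by rewrite /l lnK ?posrE ?divr_gt0// invf_div.
have -> : A `^ (k - 1 / 2) = `|l| `^ (k - 1 / 2) / D `^ ((2 * k - 1) / 4).
  rewrite /A powRM ?invr_ge0 ?(ltW r0)//; congr (_ * _).
  rewrite -(powR_inv1 (ltW r0)) -(powR12_sqrt (ltW D_gt0)) -!powRrM -powRN.
  by congr (_ `^ _); field.
have D0 : 0 < D `^ ((2 * k - 1) / 4) by rewrite powR_gt0.
have s2pi : 0 < Num.sqrt (2 * pi) :> R by rewrite sqrtr_gt0 mulr_gt0// pi_gt0.
set M := bessel_moment _ _ _; set E := expR _; set L := `|l| `^ _.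
rewrite !invfM.
set Gi := (gamma_fun k)^-1; set Di := (D `^ _)^-1; set Pi := (Num.sqrt (2 * pi))^-1.
by field; rewrite !gt_eqF.
Qed.

End gamma_mixture.

(** * Evaluation of a process at an independent random time *)

Section random_time.
Context (R : realType) (d : measure_display) (Omega : measurableType d).
Variables (P : probability Omega R) (B : R -> Omega -> R) (T : {RV P >-> R}).
Hypothesis measurable_B : forall t : R, 0 <= t -> measurable_fun setT (B t).
Hypothesis indep : independent_of_process P T B.

(** The generators of [process_events B]; naming them lets the sample space carry
    the generated sigma-algebra as a second measurable structure. *)
Definition process_cylinders : set (set Omega) :=
  [set C | exists t : R, exists A : set R,
    [/\ 0 <= t, measurable A & C = B t @^-1` A]].

Definition path_space : Type := g_sigma_algebraType process_cylinders.
HB.instance Definition _ := Measurable.on path_space.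

Definition to_path : Omega -> path_space := id.

Lemma measurable_to_path : measurable_fun setT to_path.
Proof.
apply: (@measurability _ _ Omega path_space setT to_path process_cylinders) => //.
move=> _ [_ [t [A [t0 mA ->]]] <-]; rewrite setTI.
by rewrite -[X in measurable X]setTI; exact: measurable_B.
Qed.

HB.instance Definition _ := @isMeasurableFun.Build _ _ Omega path_space to_path
  measurable_to_path.

Definition time_and_path (w : Omega) : R * path_space := (T w, to_path w).

Lemma measurable_time_and_path : measurable_fun setT time_and_path.
Proof. by apply: measurable_fun_pair => //; exact: measurable_to_path. Qed.

HB.instance Definition _ := @isMeasurableFun.Build _ _ Omega (R * path_space)%type
  time_and_path measurable_time_and_path.

(** By independence the joint law agrees with the product measure on rectangles. *)
Lemma time_and_path_law (E : set (R * path_space)) : measurable E ->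
  P (time_and_path @^-1` E) =
  (\int[distribution P T]_t P (to_path @^-1` (xsection E t)))%E.
Proof.
move=> mE.
rewrite -[LHS]/(distribution P time_and_path E).
by rewrite -(@product_measure_unique _ _ _ _ R (distribution P T)
  (distribution P to_path) (distribution P time_and_path)).
Qed.

Lemma measurable_path_section (E : set (R * path_space)) : measurable E ->
  measurable_fun setT (fun t => P (to_path @^-1` (xsection E t))).
Proof. by move=> mE; exact: (measurable_fun_xsection (distribution P to_path) mE). Qed.

Definition time_grid (n : nat) (t : R) : R :=
  (Num.truncn (t * n.+1%:R))%:R / n.+1%:R.

Lemma time_grid_ge0 n t : 0 <= time_grid n t.
Proof. exact: divr_ge0. Qed.

Lemma cvg_time_grid t : 0 <= t -> time_grid n t @[n --> \oo] --> t.
Proof.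
move=> t0; apply/cvgrPdist_le => e e0; near=> n.
have n0 : 0 < n.+1%:R :> R by [].
have /truncn_itv/andP[h1 h2] : 0 <= t * n.+1%:R by exact: mulr_ge0.
have {}h2 : t * n.+1%:R <= (Num.truncn (t * n.+1%:R))%:R + 1 by rewrite natr1 ltW.
rewrite /time_grid.
have ne : n.+1%:R^-1 <= e by apply: ltW; near: n; exact: (near_infty_natSinv_lt (PosNum e0)).
have tE : t = t * n.+1%:R / n.+1%:R by rewrite mulfK.
rewrite [X in `|X - _|]tE -mulrBl ger0_norm ?divr_ge0 ?subr_ge0//.
by apply: le_trans ne; rewrite ler_pdivrMr// mulVf ?gt_eqF// lerBlDl.
Unshelve. all: by end_near. Qed.

(** The upper limit is taken in the extended reals, where it always exists and is
    measurable; [fine] only matters along discontinuous paths. *)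
Definition path_limit (z : R * path_space) : R :=
  fine (limn_esup (fun n => (B (time_grid n z.1) z.2)%:E)).

Lemma path_limitE (w : Omega) (t : R) : 0 <= t ->
  {within `[0, +oo[, continuous (fun t => B t w)} -> path_limit (t, w) = B t w.
Proof.
move=> t0 /subspace_continuousP/(_ t) c.
have {}c : B (time_grid n t) w @[n --> \oo] --> B t w.
  have t0' : (`[0, +oo[%classic : set R) t by rewrite /= in_itv/= t0.
  apply: (@cvg_comp _ _ _ (time_grid ^~ t) (B ^~ w) _ _ _ _ (c t0')).
  move=> U UU.
  have h : \forall n \near \oo, (`[0, +oo[%classic : set R) (time_grid n t) ->
    U (time_grid n t) := cvg_time_grid t0 UU.
  apply: (@filterS _ _ _ _ _ _ h) => n /=; apply.
  by rewrite in_itv/= time_grid_ge0.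
have {}c : (B (time_grid n t) w)%:E @[n --> \oo] --> (B t w)%:E.
  by apply: cvg_EFin => //; exact: nearW.
rewrite /path_limit is_cvg_limn_esupE/=; last by apply/cvg_ex; exists (B t w)%:E.
by move/cvg_lim : c => ->.
Qed.

(** On the grid of mesh 1 / (n + 1) the preimage of a Borel set is a countable
    union of rectangles. *)
Lemma measurable_path_limit : measurable_fun setT path_limit.
Proof.
have mf n : measurable_fun setT (fun z : R * path_space => (B (time_grid n z.1) z.2)%:E).
  apply/measurable_EFinP => _ Y mY; rewrite setTI.
  have -> : (fun z : R * path_space => B (time_grid n z.1) z.2) @^-1` Y =
      \bigcup_j ([set t : R | Num.truncn (t * n.+1%:R) = j] `*`
        (B (j%:R / n.+1%:R) @^-1` Y : set path_space)).
    apply/seteqP; split => [[t w] /= Yz|[t w] [j _ /= [tj]]].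
      by exists (Num.truncn (t * n.+1%:R)).
    by rewrite /time_grid tj.
  apply: bigcupT_measurable => j; apply: measurableX; last first.
    by apply: sub_sigma_algebra; exists (j%:R / n.+1%:R), Y; split => //; exact: divr_ge0.
  have mt : measurable_fun setT (fun t : R => (Num.truncn (t * n.+1%:R))%:R : R).
    apply: nondecreasing_measurable => // s t st.
    by rewrite ler_nat le_truncn// ler_pM2r.
  have -> : [set t : R | Num.truncn (t * n.+1%:R) = j] =
      (fun t : R => (Num.truncn (t * n.+1%:R))%:R : R) @^-1` [set j%:R].
    by apply/seteqP; split => [t /= -> //|t /= /eqP]; rewrite eqr_nat => /eqP.
  by rewrite -[X in measurable X]setTI; apply: mt.
apply: measurableT_comp; first exact: fine_measurable.
exact: (measurable_fun_limn_esup mf).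
Qed.

End random_time.

Section ae_measure.
Context (R : realType) (d : measure_display) (Omega : measurableType d).
Variable P : probability Omega R.

Lemma ae_le_measure (X Y : set Omega) : measurable X -> measurable Y ->
  {ae P, forall w, X w -> Y w} -> (P X <= P Y)%E.
Proof.
move=> mX mY [N [mN N0 XYN]].
apply: (@le_trans _ _ (P (Y `|` N))).
  apply: le_measure; rewrite ?inE//; first exact: measurableU.
  move=> w Xw; have [Yw|nYw] := pselect (Y w); first by left.
  by right; apply: XYN => /= /(_ Xw).
by apply: (le_trans (measureU2 _ mY mN)); rewrite [X in (_ + X)%E]N0 adde0.
Qed.

Lemma ae_eq_measure (X Y : set Omega) : measurable X -> measurable Y ->
  {ae P, forall w, X w <-> Y w} -> P X = P Y.
Proof.
move=> mX mY XY; apply/eqP; rewrite eq_le !ae_le_measure//.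
- by apply: filterS XY => w [].
- by apply: filterS XY => w [].
Qed.

Lemma brownian_marginal (B : R -> Omega -> R) (t : R) (A : set R) :
  is_brownian_motion P B -> 0 < t -> measurable A ->
  P (B t @^-1` A) = normal_prob 0 (Num.sqrt t) A.
Proof.
move=> hB t0 mA.
have mB s : 0 <= s -> measurable_fun setT (B s) by exact: bm_measurable hB s.
rewrite -[t in RHS]subr0 -(bm_increments_gaussian hB (lexx 0) t0 mA).
apply: ae_eq_measure.
- by rewrite -[X in measurable X]setTI; apply: mB => //; exact: ltW.
- rewrite -[X in measurable X]setTI; apply: measurable_funB => //; apply: mB => //.
  exact: ltW.
- by apply: filterS (bm_start hB) => w /= ->; rewrite subr0.
Qed.

End ae_measure.

(** * The density of the stopped geometric Brownian motion *)

Section mixture_density.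
Context {R : realType}.
Local Notation leb := (@lebesgue_measure R).
Variables (mu sigma S0 k lambda : R).
Hypotheses (sigma_gt0 : 0 < sigma) (S0_gt0 : 0 < S0) (lambda_gt0 : 0 < lambda).

Let joint (z : R * R) : \bar R :=
  (gbm_pdf mu sigma S0 z.1 z.2 * gamma_pdf k lambda z.1)%:E.

Let joint_ge0 z : (0 <= joint z)%E.
Proof. by rewrite lee_fin mulr_ge0 ?gbm_pdf_ge0 ?gamma_pdf_ge0. Qed.

Let measurable_joint : measurable_fun setT joint.
Proof.
apply/measurable_EFinP; apply: measurable_funM; first exact: measurable_gbm_pdf.
by apply: (measurableT_comp (measurable_gamma_pdf _ _)).
Qed.

(** Measurability of the explicit density comes from Fubini's theorem rather than
    from properties of the Bessel function. *)
Let gbm_gamma_pdfE x : gbm_gamma_pdf S0 mu sigma k lambda x =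
  if (0 < x) && (x != S0) then fine (\int[leb]_t joint (t, x))%E else 0.
Proof.
case: ifPn => [/andP[x0 xS0]|]; last by rewrite /gbm_gamma_pdf => /negbTE ->.
by rewrite gbm_gamma_mixture.
Qed.

Lemma gbm_gamma_pdf_ge0 x : 0 <= gbm_gamma_pdf S0 mu sigma k lambda x.
Proof. by rewrite gbm_gamma_pdfE; case: ifP => // _; apply/fine_ge0/integral_ge0. Qed.

Lemma measurable_gbm_gamma_pdf :
  measurable_fun setT (gbm_gamma_pdf S0 mu sigma k lambda).
Proof.
apply: (eq_measurable_fun (fun x : R =>
    if (0 < x) && (x != S0) then fine (\int[leb]_t joint (t, x))%E else 0)).
  by move=> x _; rewrite gbm_gamma_pdfE.
apply: measurable_fun_ifT => //.
- apply: measurable_and; first exact: measurable_fun_ltr.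
  by apply: measurable_neg; exact: measurable_fun_eqr.
- apply: measurableT_comp; first exact: fine_measurable.
  exact: (measurable_fun_fubini_tonelli_G (m1 := leb) joint measurable_joint
      joint_ge0).
Qed.

Lemma integral_gbm_gamma (A : set R) : measurable A ->
  (\int[leb]_t ((\int[leb]_(x in A) (gbm_pdf mu sigma S0 t x)%:E)
     * (gamma_pdf k lambda t)%:E) =
   \int[leb]_(x in A) (gbm_gamma_pdf S0 mu sigma k lambda x)%:E)%E.
Proof.
move=> mA.
pose h (z : R * R) := (joint z * (\1_A z.2)%:E)%E.
have mh : measurable_fun setT h.
  apply: emeasurable_funM => //; apply/measurable_EFinP.
  by apply: (@measurableT_comp _ _ _ _ _ _ (\1_A : R -> R)) => //; exact: measurable_indic.
have h0 z : (0 <= h z)%E by rewrite mule_ge0// lee_fin.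
transitivity (\int[leb]_t \int[leb]_x h (t, x))%E.
  apply: eq_integral => t _; rewrite -ge0_integralZr//; last 3 first.
  - by apply: measurable_funTS; apply/measurable_EFinP; exact: measurable_gbm_pdf.
  - by move=> x _; rewrite lee_fin gbm_pdf_ge0.
  - by rewrite lee_fin gamma_pdf_ge0.
  by rewrite integral_mkcond; apply: eq_integral => x _; rewrite epatch_indic.
rewrite (@fubini_tonelli _ _ _ _ R leb leb h)//.
transitivity (\int[leb]_x ((\int[leb]_t joint (t, x)) * (\1_A x)%:E))%E.
  apply: eq_integral => x _; rewrite -ge0_integralZr//.
  by apply: (measurable_fun_pair1 (f := joint)).
rewrite [RHS]integral_mkcond.
apply: ae_eq_integral => //.
- apply: emeasurable_funM.
    exact: (measurable_fun_fubini_tonelli_G (m1 := leb) joint measurable_joint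
      joint_ge0).
  by apply/measurable_EFinP; exact: measurable_indic.
- apply/(measurable_restrictT _ mA)/measurable_funTS/measurable_EFinP.
  exact: measurable_gbm_gamma_pdf.
(* At x = S0 the mixture integral diverges for small k, while the explicit density
   is set to 0 there. *)
exists [set S0]; split => //; first exact: lebesgue_measure_set1.
move=> x /= nx; apply: contrapT => xS0; apply: nx => _.
rewrite epatch_indic; congr (_ * _)%E.
have [x0|x0] := ltP 0 x.
  by rewrite gbm_gamma_mixture//; apply/eqP.
rewrite /gbm_gamma_pdf ltNge x0/=; apply: integral0_eq => t _.
by rewrite /joint /gbm_pdf/= [0 < x]ltNge x0 andbF mul0r.
Qed.

End mixture_density.

Theorem mainTheorem3 (R : realType) (d : measure_display)
    (Omega : measurableType d) (P : probability Omega R)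
    (B : R -> Omega -> R) (T : {RV P >-> R}) (mu sigma S0 k lambda : R)
    (hsigma : 0 < sigma) (hS0 : 0 < S0) (hk : 0 < k) (hlambda : 0 < lambda)
    (hB : is_brownian_motion P B)
    (hT : has_pdf T (gamma_pdf k lambda))
    (hindep : independent_of_process P T B) :
  exists ST : {RV P >-> R},
    {ae P, forall w, ST w = geometric_bm S0 mu sigma B (T w) w} /\
    has_pdf ST (gbm_gamma_pdf S0 mu sigma k lambda).
Proof.
have mB t : 0 <= t -> measurable_fun setT (B t) by exact: bm_measurable hB t.
pose S' (z : R * path_space B) : R :=
  S0 * expR (log_drift mu sigma * z.1 + sigma * path_limit z).
have mS' : measurable_fun setT S'.
  apply: measurable_funM => //; apply: measurableT_comp => //.
  apply: measurable_funD; first exact: measurable_funM.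
  by apply: measurable_funM => //; exact: measurable_path_limit.
pose ST0 := S' \o time_and_path B T.
have mST0 : measurable_fun setT ST0.
  exact: measurableT_comp mS' (measurable_time_and_path T mB).
pose ST : {RV P >-> R} := HB.pack ST0 (isMeasurableFun.Build _ _ _ _ _ mST0).
have [mpdf pdf0 pdfE] := hT.
exists ST; split.
  have T0 : {ae P, forall w, 0 <= T w}.
    exists (T @^-1` `]-oo, 0[); split.
    - by rewrite -[X in measurable X]setTI; exact: measurable_funP.
    - rewrite -[LHS]/(distribution P T `]-oo, 0[) pdfE//.
      apply: integral0_eq => t /=; rewrite in_itv/= /gamma_pdf => t0.
      by rewrite ltNge (ltW t0).
    - by move=> w /= /negP; rewrite -ltNge in_itv.
  apply: filterS2 T0 (bm_continuous hB) => w T0 cw.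
  by rewrite /ST/= /ST0 /S'/= path_limitE.
split; [exact: measurable_gbm_gamma_pdf|exact: gbm_gamma_pdf_ge0|].
move=> A mA.
have mE : measurable (S' @^-1` A) by rewrite -[X in measurable X]setTI; exact: mS'.
(* Condition on T, then replace S' by the process at each fixed time t > 0. *)
transitivity (P (time_and_path B T @^-1` (S' @^-1` A))) => //.
rewrite (time_and_path_law mB hindep mE) -integral_gbm_gamma//.
have -> : (\int[distribution P T]_t P (to_path B @^-1` xsection (S' @^-1` A) t) =
    \int[lebesgue_measure]_t (P (to_path B @^-1` xsection (S' @^-1` A) t)
      * (gamma_pdf k lambda t)%:E))%E.
  apply: (@ge0_integral_image_density _ _ _ _ R lebesgue_measure (distribution P T) id) => //.
  exact: (measurable_path_section P mB mE).
apply: eq_integral => t _.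
have [t0|t0] := leP t 0; first by rewrite /gamma_pdf ltNge t0/= !mule0.
congr (_ * _)%E.
have mF : measurable_fun setT (fun b : R => S0 * expR (log_drift mu sigma * t + sigma * b)).
  apply: measurable_funM => //; apply: measurableT_comp => //.
  by apply: measurable_funD => //; exact: measurable_funM.
rewrite -normal_prob_gbm// -(brownian_marginal hB t0); last first.
  by rewrite -[X in measurable X]setTI; exact: mF.
apply: ae_eq_measure.
- rewrite -[X in measurable X]setTI; apply: (measurable_to_path mB) => //.
  exact: measurable_xsection.
- rewrite -[X in measurable X]setTI.
  exact: (measurableT_comp mF (mB _ (ltW t0))).
- apply: filterS (bm_continuous hB) => w cw.
  by rewrite /= /xsection/= in_setE/= /S'/= path_limitE// ltW.
Qed.
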